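(* For every integer $n\geq 1$ there exists a compact metric space $Y$ of topological dimension $n$ and a homeomorphism $S\colon Y\to Y$ which is weakly mixing and completely scrambled.
   Context: Let $(X,d)$ be a compact metric space and $T\colon X\to X$ continuous. A pair $x,y\in X$ is proximal if $\liminf_{n\to\infty} d(T^n(x),T^n(y))=0$, asymptotic if $\limsup_{n\to\infty} d(T^n(x),T^n(y))=0$, and Li-Yorke if it is proximal but not asymptotic. $(X,T)$ is completely scrambled if every pair of distinct points is a Li-Yorke pair. $(X,T)$ is transitive if for any nonempty open $U,V$ there is $n>0$ with $T^n(U)\cap V\neq\emptyset$, and weakly mixing if $(X\times X,T\times T)$ is transitive. Dimension means topological (covering) dimension. *)

(* Defs.v *)
From Stdlib Require Import Reals List.
Open Scope R_scope.
Set Implicit Arguments.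

Section Metric.
Variable X : Type.
Variable d : X -> X -> R.

Definition is_metric : Prop :=
  (forall x y, 0 <= d x y) /\
  (forall x y, d x y = 0 <-> x = y) /\
  (forall x y, d x y = d y x) /\
  (forall x y z, d x z <= d x y + d y z).

Definition is_open (U : X -> Prop) : Prop :=
  forall x, U x -> exists eps, 0 < eps /\ forall y, d x y < eps -> U y.

Definition compact_space : Prop :=
  forall (I : Type) (U : I -> X -> Prop),
    (forall i, is_open (U i)) -> (forall x, exists i, U i x) ->
    exists l : list I, forall x, exists i, In i l /\ U i x.

Definition continuous (f : X -> X) : Prop :=
  forall x eps, 0 < eps -> exists delta, 0 < delta /\
    forall y, d x y < delta -> d (f x) (f y) < eps.

Definition homeomorphism (f : X -> X) : Prop :=
  continuous f /\ exists g : X -> X, continuous g /\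
    (forall x, g (f x) = x) /\ (forall x, f (g x) = x).

Definition finite_open_cover (C : list (X -> Prop)) : Prop :=
  (forall U, In U C -> is_open U) /\ (forall x, exists U, In U C /\ U x).

Definition refines (V C : list (X -> Prop)) : Prop :=
  forall W, In W V -> exists U, In U C /\ forall x, W x -> U x.

Definition order_le (V : list (X -> Prop)) (n : nat) : Prop :=
  forall (x : X) (idx : list nat), NoDup idx ->
    (forall i, In i idx -> (i < length V)%nat /\ nth i V (fun _ => False) x) ->
    (length idx <= S n)%nat.

Definition covdim_le (n : nat) : Prop :=
  forall C, finite_open_cover C ->
    exists V, finite_open_cover V /\ refines V C /\ order_le V n.

Definition covering_dim (n : nat) : Prop :=
  covdim_le n /\ forall m, covdim_le m -> (n <= m)%nat.

Definition proximal (T : X -> X) (x y : X) : Prop :=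
  forall eps, 0 < eps -> forall N : nat, exists k, (N <= k)%nat /\
    d (Nat.iter k T x) (Nat.iter k T y) < eps.

Definition asymptotic (T : X -> X) (x y : X) : Prop :=
  forall eps, 0 < eps -> exists N : nat, forall k, (N <= k)%nat ->
    d (Nat.iter k T x) (Nat.iter k T y) < eps.

Definition li_yorke (T : X -> X) (x y : X) : Prop :=
  proximal T x y /\ ~ asymptotic T x y.

Definition completely_scrambled (T : X -> X) : Prop :=
  forall x y, x <> y -> li_yorke T x y.

Definition transitive (T : X -> X) : Prop :=
  forall U V, is_open U -> is_open V -> (exists x, U x) -> (exists y, V y) ->
    exists k : nat, (0 < k)%nat /\ exists x, U x /\ V (Nat.iter k T x).

End Metric.

(* product metric (max metric), which induces the product topology *)
Definition prod_metric (X : Type) (d : X -> X -> R) (p q : X * X) : R :=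
  Rmax (d (fst p) (fst q)) (d (snd p) (snd q)).

Definition prod_map (X : Type) (T : X -> X) (p : X * X) : X * X :=
  (T (fst p), T (snd p)).

Definition weakly_mixing (X : Type) (d : X -> X -> R) (T : X -> X) : Prop :=
  transitive (prod_metric d) (prod_map T).

(* Main.v *)
(* Idea. Let G_n be the hedgehog made of p_n segments glued at one end; a point is
   a pair (c, s) of an amplitude c in [0,1] and a phase s mod p_n, all points of
   amplitude 0 being identified. Rotations act on the phase. A bonding map
   G_(n+1) -> G_n sends (c, t) to (c h(t), phi(t)), where h is a trapezoidal wave
   of very small slope and phi(t) = t + const on each cell between two zeros of h;
   it therefore almost commutes with the rotations by 1. The space Y is the inverse
   limit of the powers G_n^m, and the rotations converge to a homeomorphism T of Y.
   - T^(p_n) is uniformly close to the identity, so no pair of distinct points is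
     asymptotic; all amplitudes are simultaneously small at suitable times, so
     every pair is proximal.
   - The phase shifts of consecutive cells form a staircase, so one and the same
     time k works for all pairs of prescribed phases; this gives weak mixing.
   - G_n is one-dimensional: cutting its segments at m + 1 disjoint families of
     points gives covers of G_n^m of order m. Conversely G_0^m = [0,1]^m, the
     projection of Y to it has a section, and Lebesgue's covering theorem follows
     from Sperner's lemma. *)

(* Rigidity along the times [per n] and free prescription of phases pull against each other; the
   constants separate their scales. The homeomorphism follows the rotation of level n up to [eta n],
   a bound for the tail of the series of slopes 1 / [ramp n]. The factor [S n] in [ramp n] makes the
   drift over a whole period, [per n * eta n] = 2 / (n + 1), tend to 0. A cell of level n fits into
   one period of level n + 1: crossing it is long for level n, yet still an almost exact rotation
   one level up. A plateau is longer than [per n], so every phase occurs on it at full height, and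
   [per n + 1] cells provide the successive phase shifts 1, ..., [per n], that is, all residues.
   Since [ramp n] and [cell n] are multiples of [per n], only these shifts affect the phase at which
   a plateau begins. *)
Require Import Defs.
From Stdlib Require Import Reals List.
From Stdlib Require Import ZArith Lra Lia Classical ClassicalEpsilon
  FunctionalExtensionality ProofIrrelevance.
From mathcomp Require all_boot all_fingroup zify.
Open Scope R_scope.

(** * Sperner's lemma on Kuhn's triangulation *)

Module Sperner.
Import mathcomp.boot.all_boot mathcomp.fingroup.all_fingroup mathcomp.zify.zify.
Set Implicit Arguments.
Unset Strict Implicit.
Unset Printing Implicit Defensive.
Local Open Scope nat_scope.

Lemma even_card_involution (T : finType) (f : T -> T) (A : {set T}) :
  (forall x, x \in A -> [/\ f x \in A, f (f x) = x & f x != x]) ->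
  odd #|A| = false.
Proof.
elim: {A}#|A| {-2}A (leqnn #|A|) => [|n IHn] A leA fA.
  by move: leA; rewrite leqn0 => /eqP ->.
have [->|[x xA]] := set_0Vmem A; first by rewrite cards0.
have [fxA ffx fxx] := fA x xA.
rewrite (cardsD1 x A) xA (cardsD1 (f x) (A :\ x)) !inE fxx fxA /= negbK.
apply: IHn => [|y].
  have := cardsD1 x A; have := cardsD1 (f x) (A :\ x).
  by rewrite !inE fxx fxA xA /=; lia.
rewrite !inE => /and3P[yfx yx yA]; have [fyA ffy fyy] := fA y yA.
split=> //; rewrite fyA andbT; apply/andP; split.
  by apply: contra yx => /eqP e; rewrite -ffy e ffx.
by apply: contra yfx => /eqP <-; rewrite ffy.
Qed.

(** * Parity of the doors of one labelled simplex *)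

Section Doors.
Variables (n : nat) (l : 'I_n.+1 -> nat).

Definition door (j : nat) :=
  [forall a : 'I_n, [exists i : 'I_n.+1, (i != j :> nat) && (l i == a)]].
Definition full := [forall a : 'I_n.+1, [exists i, l i == a]].

(** The n labels below n need n distinct indices, and only n indices differ from j. *)
Lemma door_bij (j : 'I_n.+1) : door j ->
  exists g : 'I_n -> 'I_n.+1, (forall a, l (g a) = a) /\
    (forall i, i != j -> exists a, i = g a).
Proof.
move=> /forallP dj.
have dj' (a : 'I_n) : exists i : 'I_n.+1, (i != j) && (l i == a).
  by have /existsP[i di] := dj a; exists i.
pose g (a : 'I__) := xchoose (dj' a).
have gP a : (g a != j) && (l (g a) == a) by exact: (xchooseP (dj' a)).
have lg a : l (g a) = a by have /andP[_ /eqP] := gP a.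
exists g; split=> // i ij.
have gi : injective g by move=> a b e; apply: val_inj; rewrite /= -(lg a) e lg.
have sub : [set g a | a : 'I_n] \subset [set~ j].
  by apply/subsetP => _ /imsetP[a _ ->]; rewrite !inE; have /andP[] := gP a.
have eqc : [set g a | a : 'I_n] = [set~ j].
  by apply/eqP; rewrite eqEcard sub cardsC1 card_ord card_imset // card_ord leqnn.
have : i \in [set~ j] by rewrite !inE.
by rewrite -eqc => /imsetP[a _ ->]; exists a.
Qed.

(** If all labels occur, each occurs once and the only door omits the index labelled n. Otherwise,
    given a door j, the other indices carry each label below n once; [l j] repeats the label of
    exactly one of them, j', and the doors are j and j'. *)
Lemma odd_doors : (forall i, l i <= n) ->
  odd #|[set j : 'I_n.+1 | door j]| = full.
Proof.
move=> ln; case: (boolP full) => [fl|nfl].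
  have dj' (a : 'I_n.+1) : exists i, l i == a by apply/existsP; exact: (forallP fl a).
  pose g (a : 'I__) := xchoose (dj' a).
  have lg a : l (g a) = a by apply/eqP; exact: (xchooseP (dj' a)).
  have gi : injective g by move=> a b e; apply: val_inj; rewrite /= -(lg a) e lg.
  have gs i : exists a, i = g a.
    by have [h _ hK] := injF_bij gi; exists (h i).
  have li : injective l.
    move=> i i'; have [a ->] := gs i; have [b ->] := gs i'.
    by rewrite !lg => /val_inj ->.
  suff -> : [set j : 'I_n.+1 | door j] = [set g ord_max] by rewrite cards1.
  apply/setP => j; rewrite !inE; apply/idP/eqP => [dj|->].
    have [a ja] := gs j; rewrite ja; congr g; apply: val_inj => /=.
    have := ltn_ord a; rewrite ltnS leq_eqVlt => /orP[/eqP //|an].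
    have /existsP[i /andP[ij /eqP lia]] := forallP dj (Ordinal an).
    have : i = j by apply: li; rewrite lia ja lg.
    by move=> e; rewrite e eqxx in ij.
  apply/forallP => a; apply/existsP; exists (g (widen_ord (leqnSn n) a)).
  rewrite lg /= eqxx andbT; apply/eqP => /val_inj/gi e.
  by have := congr1 val e => /=; have := ltn_ord a; lia.
have [->|[j]] := set_0Vmem [set j : 'I_n.+1 | door j]; first by rewrite cards0.
rewrite inE => dj; have [g [lg gs]] := door_bij dj.
have inj i i' : i != j -> i' != j -> l i = l i' -> i = i'.
  by move=> /gs[a ->] /gs[b ->]; rewrite !lg => /val_inj ->.
have ljn : l j < n.
  rewrite ltn_neqAle ln andbT; apply: contra nfl => /eqP ljn.
  apply/forallP => a; apply/existsP.
  have := ltn_ord a; rewrite ltnS leq_eqVlt => /orP[/eqP an|an].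
    by exists j; rewrite ljn an.
  by exists (g (Ordinal an)); rewrite lg.
have [j' [jj' lj']] : exists j', j' != j /\ l j' = l j.
  have /existsP[i /andP[ij /eqP li]] := forallP dj (Ordinal ljn).
  by exists i; rewrite li.
suff -> : [set j : 'I_n.+1 | door j] = [set j; j'] by rewrite cards2 eq_sym jj'.
apply/setP => i; rewrite !inE; apply/idP/orP => [di|[/eqP->//|/eqP->]]; last first.
  apply/forallP => a; apply/existsP.
  have /existsP[i' /andP[ij /eqP li]] := forallP dj a.
  have [e|ne] := eqVneq (i' : nat) j'.
    exists j; rewrite -lj' -li -(val_inj e) eqxx andbT.
    by rewrite eq_sym.
  by exists i'; rewrite ne li eqxx.
case: (eqVneq i j) => [|ij]; [by left|right].
have [a ia] := gs i ij.
have /existsP[i' /andP[ii' /eqP li']] := forallP di a.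
have [e|ne] := eqVneq i' j.
  by apply/eqP/inj => //; rewrite lj' -e li' ia lg.
have e : i' = i by apply: inj => //; rewrite li' ia lg.
by rewrite e eqxx in ii'.
Qed.

End Doors.

(* A simplex of Kuhn's triangulation of the grid: the edge path that starts at
   the corner [s.1] of a unit cube and runs along direction [i] at time [s.2 i]. *)
Section Kuhn.
Variables (m N : nat) (lab : {ffun 'I_m -> nat} -> nat).
Notation simplex := ({ffun 'I_m -> 'I_N.+1} * 'S_m)%type.
Hypothesis lab_le : forall v, lab v <= m.
Hypothesis lab_low : forall (v : {ffun 'I_m -> nat}) i, v i = 0 -> lab v <= i.
Hypothesis lab_high : forall (v : {ffun 'I_m -> nat}) i, v i = N.+1 -> lab v <> i.

Definition vert (s : simplex) (j : nat) : {ffun 'I_m -> nat} :=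
  [ffun i => s.1 i + (s.2 i < j)].

(** Encodes the k-simplices of the face where the coordinates from k on vanish: the path is
    continued in a fixed way by the directions k, k + 1, ..., so each such simplex is counted once,
    through its vertices 0 to k. *)
Definition supp (k : nat) (s : simplex) :=
  [forall i : 'I_m, (k <= i) ==> ((s.1 i == 0 :> nat) && (s.2 i == i))].

Definition slab k (s : simplex) (i : 'I_k.+1) := lab (vert s i).

Lemma supp_slab k s (i : 'I_k.+1) : k <= m -> supp k s -> slab s i <= k.
Proof.
move=> km /forallP sk; rewrite /slab.
move: km; rewrite leq_eqVlt => /orP[/eqP e|km]; first by rewrite [leqRHS]e lab_le.
have /implyP/(_ (leqnn _))/andP[/eqP v0 /eqP p0] := sk (Ordinal km).
apply: (lab_low (i := Ordinal km)); rewrite ffunE v0 p0 /=.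
by have := ltn_ord i; lia.
Qed.

Definition cells k := [set s : simplex | supp k s && full (@slab k s)].

Lemma odd_cells0 : odd #|cells 0|.
Proof.
suff -> : cells 0 = [set ([ffun => ord0], 1%g)] by rewrite cards1.
apply/setP => [[v p]]; rewrite !inE; apply/idP/eqP => [/andP[/forallP sk _]|->].
  congr pair; [apply/ffunP => i|apply/permP => i];
    have /implyP/(_ (leq0n _))/andP[/eqP v0 /eqP p0] := sk i.
    by rewrite ffunE; apply: val_inj.
  by rewrite p0 perm1.
have s0 : supp 0 ([ffun => ord0], 1%g).
  by apply/forallP => i; rewrite /= ffunE perm1 !eqxx.
rewrite s0 /=; apply/forallP => a; apply/existsP; exists ord0.
have := supp_slab (ord0 : 'I_1) (leq0n m) s0; rewrite leqn0 => /eqP ->.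
by rewrite [a]ord1.
Qed.

Section Step.
Variable k : nat.
Hypothesis km : k < m.

Definition time (t : nat) : 'I_m := insubd (Ordinal km) t.

Lemma timeK t : t <= k -> time t = t :> nat.
Proof. by move=> tk; rewrite val_insubd (leq_ltn_trans tk km). Qed.

(** Dropping the first vertex of a path moves all times forward by one; the direction used first is
    then reused as the last of the times 0, ..., k. *)
Definition shift_time (t : 'I_m) :=
  if t == 0 :> nat then time k else if t <= k then time t.-1 else t.

Lemma shift_timeE t : shift_time t =
  (if t == 0 :> nat then k else if t <= k then t.-1 else t) :> nat.
Proof.
rewrite /shift_time; case: ifP => _; first by rewrite timeK.
by case: ifP => // tk; rewrite timeK //; lia.
Qed.

Lemma shift_time_inj : injective shift_time.
Proof.
move=> t t' /(congr1 val) /=; rewrite !shift_timeE => e; apply: val_inj => /=.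
by move: e; do 4?case: ifP => //; lia.
Qed.

Definition shift_perm := perm shift_time_inj.

Lemma shift_permE t : shift_perm t =
  (if t == 0 :> nat then k else if t <= k then t.-1 else t) :> nat.
Proof. by rewrite permE shift_timeE. Qed.

(** [swap], [fwd] and [bwd] give the simplex across the facet opposite to a vertex: an inner vertex
    is replaced by exchanging the two steps next to it, an end vertex by prolonging the path at its
    other end. The [inord] in the last two is faithful as long as the path stays inside the grid. *)
Definition swap (j : nat) (s : simplex) : simplex :=
  (s.1, (s.2 * tperm (time j.-1) (time j))%g).
Definition fwd (s : simplex) : simplex :=
  ([ffun i => if s.2 i == 0 :> nat then inord (s.1 i).+1 else s.1 i],
   (s.2 * shift_perm)%g).
Definition bwd (s : simplex) : simplex :=
  ([ffun i => if s.2 i == k :> nat then inord (s.1 i).-1 else s.1 i],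
   (s.2 * shift_perm^-1)%g).

Lemma shiftV_perm0 (t : 'I_m) : ((shift_perm^-1)%g t == 0 :> nat) = (t == k :> nat).
Proof.
have [x ->] : exists x, t = shift_perm x by exists (shift_perm^-1 t)%g; rewrite permKV.
by rewrite permK shift_permE; case: ifP => [_|]; [rewrite eqxx|case: ifP; lia].
Qed.

Lemma shiftV_permN (t : 'I_m) : t != k :> nat ->
  (shift_perm^-1)%g t = (if t < k then t.+1 else t) :> nat.
Proof.
have [x ->] : exists x, t = shift_perm x by exists (shift_perm^-1 t)%g; rewrite permKV.
by rewrite permK shift_permE; do !case: ifP; lia.
Qed.

Lemma vert_swap j (s : simplex) i : 0 < j <= k -> i != j -> vert (swap j s) i = vert s i.
Proof.
move=> /andP[j0 jk] ij; apply/ffunP => x; rewrite !ffunE /= permM; congr (_ + _).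
have j1k : j.-1 <= k by lia.
by case: tpermP => [->|->|//]; rewrite !timeK //; congr nat_of_bool; apply/idP/idP; lia.
Qed.

Lemma vert_fwd (s : simplex) i : i <= k -> (forall x, s.2 x = 0 :> nat -> s.1 x < N) ->
  vert (fwd s) i = vert s i.+1.
Proof.
move=> ik sN; apply/ffunP => x; rewrite !ffunE /= permM shift_permE.
case: ifP => [/eqP x0|x0]; first by rewrite x0 inordK ?ltnS ?sN //; lia.
by congr (_ + nat_of_bool _); case: ifP; lia.
Qed.

Lemma vert_bwd (s : simplex) i : i <= k -> (forall x, s.2 x = k :> nat -> 0 < s.1 x) ->
  vert (bwd s) i.+1 = vert s i.
Proof.
move=> ik sN; apply/ffunP => x; rewrite !ffunE /= permM.
case: ifP => [/eqP xk|xk].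
  have := sN x xk; have := ltn_ord (s.1 x) => x1 x2.
  have /eqP -> : (shift_perm^-1)%g (s.2 x) == 0 :> nat by rewrite shiftV_perm0 xk.
  by rewrite inordK; lia.
by rewrite shiftV_permN ?xk //; congr (_ + nat_of_bool _); case: ifP; lia.
Qed.

Definition doors := [set sj : simplex * 'I_k.+2 |
  supp k.+1 sj.1 && door (@slab k.+1 sj.1) sj.2].

Lemma odd_sum (I : finType) (P : pred I) (F G : I -> nat) :
  (forall i, P i -> odd (F i) = odd (G i)) ->
  odd (\sum_(i | P i) F i) = odd (\sum_(i | P i) G i).
Proof.
move=> FG; apply: (big_ind2 (fun x y => odd x = odd y)) => //.
by move=> x y x' y' e e'; rewrite !oddD e e'.
Qed.

Lemma odd_doors_cells : odd #|doors| = odd #|cells k.+1|.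
Proof.
have -> : #|doors| = \sum_(s | supp k.+1 s) #|[set j : 'I_k.+2 | door (@slab k.+1 s) j]|.
  under eq_bigr do rewrite -sum1_card.
  rewrite pair_big_dep -sum1_card; apply: eq_bigl => sj.
  by rewrite !inE.
have -> : #|cells k.+1| = \sum_(s | supp k.+1 s) full (@slab k.+1 s).
  rewrite -sum1_card; under eq_bigl do rewrite inE.
  by rewrite big_mkcondr; apply: eq_bigr => s _; case: (full _).
apply: odd_sum => s ss; rewrite odd_doors ?oddb // => i.
by apply: supp_slab.
Qed.

Lemma supp_time (s : simplex) x : supp k.+1 s -> s.2 x <= k -> x <= k.
Proof.
move=> /forallP/(_ x); case: (ltnP k x) => //= kx /andP[_ /eqP ->].
by rewrite leqNgt kx.
Qed.

Lemma suppS (s : simplex) : supp k s = [&& supp k.+1 s, s.1 (Ordinal km) == ord0 & s.2 (Ordinal km) == Ordinal km].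
Proof.
apply/idP/and3P => [/forallP sk|[/forallP sk /eqP v0 /eqP p0]].
  have /implyP/(_ (leqnn _))/andP[v0 p0] := sk (Ordinal km).
  by split=> //; apply/forallP => i; apply/implyP => ki; have /implyP := sk i; apply; lia.
apply/forallP => i; apply/implyP; rewrite leq_eqVlt => /orP[/eqP e|ki].
  have -> : i = Ordinal km by apply: val_inj.
  by rewrite v0 p0 !eqxx.
by have /implyP := sk i; apply.
Qed.

Lemma door_last s : door (@slab k.+1 s) k.+1 = full (@slab k s).
Proof.
apply/forallP/forallP => H a; apply/existsP.
  have /existsP[i /andP[ik li]] := H a.
  have ik' : i < k.+1 by have := ltn_ord i; lia.
  by exists (Ordinal ik').
have /existsP[i li] := H a; exists (widen_ord (leqnSn _) i).
by rewrite /slab /= in li *; rewrite li andbT; have := ltn_ord i; lia.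
Qed.

(** The doors that lie in the face of dimension k; no simplex lies across them. *)
Definition base := [set sj : simplex * 'I_k.+2 |
  [&& sj.2 == ord_max, sj.1.1 (Ordinal km) == ord0 & sj.1.2 (Ordinal km) == Ordinal km]].

Lemma card_doors_base : #|doors :&: base| = #|cells k|.
Proof.
have -> : doors :&: base = [set (s, ord_max) | s in cells k].
  apply/setP => [[s j]]; rewrite !inE /=; apply/idP/imsetP.
    move=> /and3P[/andP[ss dj] /eqP ej /andP[v0 p0]]; exists s; last by rewrite ej.
    by rewrite inE suppS ss v0 p0 /=; rewrite ej in dj; rewrite -door_last.
  move=> [s']; rewrite inE suppS -door_last => /andP[/and3P[ss v0 p0] dl] [-> ->].
  by rewrite ss dl v0 p0 eqxx.
by rewrite card_imset // => s s' [].
Qed.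

Definition across (sj : simplex * 'I_k.+2) : simplex * 'I_k.+2 :=
  if sj.2 == ord0 then (fwd sj.1, ord_max)
  else if sj.2 == ord_max then (bwd sj.1, ord0) else (swap sj.2 sj.1, sj.2).

(** Otherwise all vertices but the first have coordinate x equal to N + 1, where the label x is
    forbidden, while a door shows every label up to k. *)
Lemma fwd_bound (s : simplex) x : supp k.+1 s -> door (@slab k.+1 s) 0 -> s.2 x = 0 :> nat ->
  s.1 x < N.
Proof.
move=> ss ds x0; rewrite ltn_neqAle -ltnS ltn_ord andbT; apply/eqP => xN.
have xk : x < k.+1 by rewrite ltnS; apply: supp_time ss _; rewrite x0.
have /existsP[i /andP[i0 /eqP]] := forallP ds (Ordinal xk).
apply: lab_high; rewrite ffunE x0 xN.
by move: i0; case: (i : nat) => // i' _; rewrite addn1.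
Qed.

(** If the coordinate were 0, the vertices 0 to k would all have labels at most x. The door shows
    the label k, so x = k and the door would belong to [base]. *)
Lemma bwd_bound (s : simplex) x : supp k.+1 s -> door (@slab k.+1 s) k.+1 -> s.2 x = k :> nat ->
  ~~ [&& s.1 (Ordinal km) == ord0 & s.2 (Ordinal km) == Ordinal km] -> 0 < s.1 x.
Proof.
move=> ss ds xk; apply: contraR; rewrite -leqNgt leqn0 => /eqP x0.
have xlek : x <= k by apply: supp_time ss _; rewrite xk.
have /existsP[i /andP[i0 /eqP li]] := forallP ds ord_max.
have kx : k <= x.
  have <- : slab s i = k by rewrite li.
  apply: lab_low; rewrite ffunE x0 xk /=.
  by have := ltn_ord i; lia.
have -> : Ordinal km = x by apply: val_inj => /=; lia.
by apply/andP; split; apply/eqP; apply: val_inj => //=; lia.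
Qed.

Lemma supp_swap j (s : simplex) : 0 < j <= k -> supp k.+1 s -> supp k.+1 (swap j s).
Proof.
move=> /andP[j0 jk] /forallP ss; apply/forallP => i; apply/implyP => ki.
have /implyP/(_ ki)/andP[v0 /eqP p0] := ss i.
rewrite /= v0 permM p0 tpermD ?eqxx //; apply/eqP => /(congr1 val) /=;
  rewrite timeK; lia.
Qed.

Lemma supp_fwd (s : simplex) : supp k.+1 s -> supp k.+1 (fwd s).
Proof.
move=> /forallP ss; apply/forallP => i; apply/implyP => ki.
have /implyP/(_ ki)/andP[v0 /eqP p0] := ss i.
have i0 : (i == 0 :> nat) = false by lia.
have ik : (i <= k) = false by lia.
by rewrite /= ffunE permM p0 i0 v0 -(inj_eq val_inj) /= shift_permE i0 ik eqxx.
Qed.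

Lemma supp_bwd (s : simplex) : supp k.+1 s -> supp k.+1 (bwd s).
Proof.
move=> /forallP ss; apply/forallP => i; apply/implyP => ki.
have /implyP/(_ ki)/andP[v0 /eqP p0] := ss i.
have i0 : (i == k :> nat) = false by lia.
have ik : (i < k) = false by lia.
by rewrite /= ffunE permM p0 i0 v0 -(inj_eq val_inj) /= shiftV_permN ?i0 // ik eqxx.
Qed.

Lemma door_swap j (s : simplex) : 0 < j <= k ->
  door (@slab k.+1 (swap j s)) j = door (@slab k.+1 s) j.
Proof.
move=> jk; apply: eq_forallb => a; apply: eq_existsb => i.
by case: (eqVneq (i : nat) j) => //= ij; rewrite /slab vert_swap.
Qed.

Lemma door_fwd (s : simplex) : (forall x, s.2 x = 0 :> nat -> s.1 x < N) ->
  door (@slab k.+1 s) 0 -> door (@slab k.+1 (fwd s)) k.+1.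
Proof.
move=> sN /forallP ds; apply/forallP => a; apply/existsP.
have /existsP[i /andP[i0 li]] := ds a.
have ik := ltn_ord i; have ik' : i.-1 < k.+2 by lia.
exists (Ordinal ik'); rewrite /slab /= vert_fwd //; last by lia.
by rewrite prednK ?lt0n //; apply/andP; split=> //; lia.
Qed.

Lemma door_bwd (s : simplex) : (forall x, s.2 x = k :> nat -> 0 < s.1 x) ->
  door (@slab k.+1 s) k.+1 -> door (@slab k.+1 (bwd s)) 0.
Proof.
move=> sN /forallP ds; apply/forallP => a; apply/existsP.
have /existsP[i /andP[i0 li]] := ds a.
have ik := ltn_ord i; have ik' : i.+1 < k.+2 by lia.
exists (Ordinal ik'); rewrite /slab /= vert_bwd //; lia.
Qed.

Lemma bwd_fwd (s : simplex) : (forall x, s.2 x = 0 :> nat -> s.1 x < N) ->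
  bwd (fwd s) = s.
Proof.
case: s => v p sN; rewrite /bwd /fwd /= mulgK; congr pair; apply/ffunP => i.
rewrite !ffunE permM shift_permE; case: (eqVneq (p i : nat) 0) => [i0|i0].
  have /= vi := sN i i0; rewrite eqxx; apply: val_inj.
  by rewrite /= !inordK //=; lia.
by case: ifP => //; case: ifP; lia.
Qed.

Lemma fwd_bwd (s : simplex) : (forall x, s.2 x = k :> nat -> 0 < s.1 x) ->
  fwd (bwd s) = s.
Proof.
case: s => v p sN; rewrite /bwd /fwd /= mulgKV; congr pair; apply/ffunP => i.
rewrite !ffunE permM shiftV_perm0; case: ifP => ik; last by rewrite ik.
apply: val_inj; have /= := sN i (eqP ik); have := ltn_ord (v i).
by move=> vi v0; rewrite ik /= !inordK //; lia.
Qed.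

Lemma swapK j (s : simplex) : swap j (swap j s) = s.
Proof. by case: s => v p; rewrite /swap /= -mulgA tperm2 mulg1. Qed.

Lemma swap_neq j (s : simplex) : 0 < j <= k -> swap j s != s.
Proof.
case: s => v p /andP[j0 jk]; apply/eqP => [[e]].
have : tperm (time j.-1) (time j) = 1%g by apply: (mulgI p); rewrite e mulg1.
move=> /permP/(_ (time j)); rewrite perm1 tpermR => /(congr1 val) /=.
by rewrite !timeK; lia.
Qed.

Lemma odd_cellsS : odd #|cells k| -> odd #|cells k.+1|.
Proof.
rewrite -odd_doors_cells -(cardsID base doors) card_doors_base oddD => ->.
rewrite (@even_card_involution _ across) // => -[s j].
rewrite !inE /= => /and3P[nb ss dj]; rewrite /across /=.
have sN x : door (@slab k.+1 s) 0 -> s.2 x = 0 :> nat -> s.1 x < N by exact: fwd_bound.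
have m0 : (ord_max == ord0 :> 'I_k.+2) = false by [].
have m0' : (ord0 == ord_max :> 'I_k.+2) = false by [].
case: (eqVneq j ord0) => [j0|j0] /=.
  rewrite j0 in dj; have {}sN x := sN x dj.
  rewrite bwd_fwd // j0; split=> //; rewrite ?inE /=.
    (* The new door avoids [base]: if direction k now has time k, it had time 0 before, so its
       corner coordinate has just been increased. *)
    rewrite supp_fwd // door_fwd // !andbT; apply/negP => /andP[_].
    rewrite ffunE permM.
    move=> /andP[/eqP v0 /eqP p0].
    have /eqP s0 : s.2 (Ordinal km) == 0 :> nat.
      have := congr1 (@nat_of_ord m) p0; rewrite shift_permE /=.
      by case: ifP => //; case: ifP; lia.
    move/(congr1 val): v0; rewrite s0 eqxx /= inordK //.
    by rewrite ltnS sN.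
  by rewrite eqxx.
  by apply/eqP => -[].
case: (eqVneq j ord_max) => [jm|jm] /=.
  rewrite jm eqxx /= in nb dj.
  have sP x : s.2 x = k :> nat -> 0 < s.1 x by move=> xk; exact: (bwd_bound ss).
  rewrite fwd_bwd // jm; split=> //; rewrite ?inE /=.
    by rewrite supp_bwd // door_bwd.
  by apply/eqP => -[].
have jk : 0 < j <= k.
  have := ltn_ord j; move: j0 jm; rewrite -!(inj_eq val_inj) /=; lia.
rewrite (negbTE j0) (negbTE jm) swapK; split=> //; rewrite ?inE /=.
  by rewrite supp_swap // door_swap.
by apply/eqP => -[e]; have := swap_neq s jk; rewrite e eqxx.
Qed.

End Step.

Lemma odd_cells k : k <= m -> odd #|cells k|.
Proof. by elim: k => [_|k IHk km]; [exact: odd_cells0|apply/odd_cellsS/IHk/ltnW]. Qed.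

Lemma kuhn : exists w : nat -> {ffun 'I_m -> nat},
  (forall a, a <= m -> lab (w a) = a /\ forall i, w a i <= N.+1) /\
  (forall a b i, w a i <= (w b i).+1).
Proof.
have : 0 < #|cells m| by rewrite odd_gt0 // odd_cells.
move=> /card_gt0P[s]; rewrite inE => /andP[_ /forallP sf].
have ex (a : 'I_m.+1) : exists i : 'I_m.+1, slab s i == a by apply/existsP; exact: sf.
pose g (a : nat) := xchoose (ex (inord a)).
(* [inord] sends indices beyond m to 0, so the closeness of [w a] and [w b] holds for all a and
   b. *)
exists (fun a => vert s (g a)); split=> [a am|a b i].
  split=> [|i]; first by rewrite -[RHS](@inordK m a am); exact: (eqP (xchooseP (ex _))).
  rewrite ffunE; apply: leq_trans (leq_add (_ : _ <= N) (leq_b1 _)) _.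
    by rewrite -ltnS ltn_ord.
  by rewrite addn1.
by rewrite !ffunE -addnS leq_add2l (leq_trans (leq_b1 _)).
Qed.

End Kuhn.

Lemma sperner (m N : nat) (lab : (nat -> nat) -> nat) :
  (forall v, le (lab v) m) ->
  (forall v i, lt i m -> v i = 0 -> le (lab v) i) ->
  (forall v i, lt i m -> v i = N.+1 -> lab v <> i) ->
  exists w : nat -> nat -> nat,
    (forall a, le a m -> lab (w a) = a /\ forall i, lt i m -> le (w a i) N.+1) /\
    (forall a b i, lt i m -> le (w a i) (w b i).+1).
Proof.
move=> lm l0 l1.
pose ext (v : {ffun 'I_m -> nat}) (i : nat) := if insub i is Some j then v j else 0.
have extE v (i : 'I_m) : ext v i = v i by rewrite /ext valK.
have [|v i vi|v i vi|w [w1 w2]] := @kuhn m N (fun v => lab (ext v)).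
- by move=> v; apply/leP.
- by apply/leP/l0; [exact/ltP|rewrite extE].
- by apply: l1; [exact/ltP|rewrite extE].
exists (fun a => ext (w a)); split=> [a /leP/w1[wa wN]|a b i /ltP im].
  split=> // i /ltP im; apply/leP.
  by rewrite (extE _ (Ordinal im)).
by apply/leP; rewrite !(extE _ (Ordinal im)).
Qed.

End Sperner.

(** * Hedgehogs and their bonding maps *)

Lemma choice (A B : Type) (P : A -> B -> Prop) :
  (forall a, exists b, P a b) -> exists f, forall a, P a (f a).
Proof.
  intros h. exists (fun a => proj1_sig (constructive_indefinite_description _ (h a))).
  intros a. apply proj2_sig.
Qed.

(** The path metric of the hedgehog: different branches are joined through the hub. Every (0, s)
    represents the hub; [norm] and [spine] single out (0, 0), which makes distance 0 mean
    equality. *)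
Definition hdist (a b : R * nat) : R :=
  if Nat.eq_dec (snd a) (snd b) then Rabs (fst a - fst b) else fst a + fst b.

Definition norm (a : R * nat) : R * nat :=
  if Req_EM_T (fst a) 0 then (0, 0%nat) else a.

Definition spine (p : nat) (a : R * nat) : Prop :=
  0 <= fst a <= 1 /\ (snd a < p)%nat /\ (fst a = 0 -> snd a = 0%nat).

Ltac hd_cases :=
  unfold hdist, Rabs; simpl;
  repeat match goal with
  | |- context [Nat.eq_dec ?a ?b] => destruct (Nat.eq_dec a b)
  | |- context [Rcase_abs ?x] => destruct (Rcase_abs x)
  end.

Lemma hdist_refl a : hdist a a = 0.
Proof. unfold hdist. destruct Nat.eq_dec; [|lia]. rewrite Rminus_diag. apply Rabs_R0. Qed.

Lemma hdist_sym a b : hdist a b = hdist b a.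
Proof. hd_cases; try lia; lra. Qed.

Lemma hdist_tri a b c : 0 <= fst a -> 0 <= fst b -> 0 <= fst c ->
  hdist a c <= hdist a b + hdist b c.
Proof. intros. hd_cases; try lia; lra. Qed.

Lemma hdist_ge0 a b : 0 <= fst a -> 0 <= fst b -> 0 <= hdist a b.
Proof. intros. hd_cases; lra. Qed.

Lemma hdist_fst a b : 0 <= fst a -> 0 <= fst b -> Rabs (fst a - fst b) <= hdist a b.
Proof. intros. hd_cases; lra. Qed.

Lemma hdist_le_sum a b : 0 <= fst a -> 0 <= fst b -> hdist a b <= fst a + fst b.
Proof. intros. hd_cases; lra. Qed.

Lemma hdist_0l a b : fst a = 0 -> 0 <= fst b -> hdist a b = fst b.
Proof. intros. hd_cases; lra. Qed.

Lemma hdist_same c s c' : hdist (c, s) (c', s) = Rabs (c - c').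
Proof. hd_cases; try lra; lia. Qed.

Lemma hdist_norm_l a b : 0 <= fst b -> hdist (norm a) b = hdist a b.
Proof.
  intros. unfold norm. destruct Req_EM_T as [e|]; [|reflexivity].
  rewrite !hdist_0l; auto.
Qed.

Lemma hdist_norm_r a b : 0 <= fst a -> hdist a (norm b) = hdist a b.
Proof. intros. rewrite hdist_sym, hdist_norm_l, hdist_sym; auto. Qed.

Lemma hdist_eq0 p a b : spine p a -> spine p b -> hdist a b = 0 -> a = b.
Proof.
  destruct a as [c s], b as [c' s']. intros (A1 & A2 & A3) (B1 & B2 & B3). simpl in *.
  unfold hdist; simpl; destruct Nat.eq_dec as [e|ne]; intros h.
  - f_equal; [|exact e]. destruct (Req_dec (c - c') 0) as [|n]; [lra|].
    now apply Rabs_no_R0 in n.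
  - exfalso; apply ne. rewrite A3, B3; [reflexivity|lra|lra].
Qed.

Lemma fst_norm a : fst (norm a) = fst a.
Proof. unfold norm. destruct Req_EM_T; simpl; auto. Qed.

Lemma spine_norm p c s : 0 <= c <= 1 -> (s < p)%nat -> spine p (norm (c, s)).
Proof.
  intros hc hs. unfold norm; simpl. destruct Req_EM_T; repeat split; simpl; auto; try lra; try lia.
Qed.

Lemma norm_spine p a : spine p a -> norm a = a.
Proof.
  destruct a as [c s]. intros (A1 & A2 & A3). unfold norm; simpl in *.
  destruct Req_EM_T; auto. rewrite A3; subst; auto.
Qed.

Fixpoint per (n : nat) : nat :=
  match n with
  | O => 1
  | S n => 4 * (per n * S n) * (per n + 1)
  end.

Definition ramp (n : nat) : nat := (per n * S n)%nat.
Definition cell (n : nat) : nat := (4 * ramp n)%nat.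

Lemma per_S n : per (S n) = (cell n * (per n + 1))%nat.
Proof. reflexivity. Qed.

Lemma per_gt0 n : (0 < per n)%nat.
Proof. induction n; simpl; lia. Qed.

Lemma ramp_gt0 n : (0 < ramp n)%nat.
Proof. unfold ramp. pose proof (per_gt0 n). nia. Qed.

Lemma ramp_pos n : 0 < INR (ramp n).
Proof. apply lt_0_INR, ramp_gt0. Qed.

Lemma per_le_ramp n : (per n <= ramp n)%nat.
Proof. unfold ramp. nia. Qed.

Lemma per_ge n : (n <= per n)%nat.
Proof.
  induction n; [lia|]. rewrite per_S. unfold cell, ramp. pose proof (per_gt0 n). nia.
Qed.

Lemma cell_le_per n : (cell n <= per (S n))%nat.
Proof. rewrite per_S. nia. Qed.

Lemma ramp_double n : (2 * ramp n <= ramp (S n))%nat.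
Proof.
  unfold ramp at 2. rewrite per_S. unfold cell. pose proof (ramp_gt0 n).
  assert (4 * ramp n <= 4 * ramp n * (per n + 1))%nat by nia. nia.
Qed.

(* Triangular numbers: consecutive cells are traversed with phase shifts whose
   differences take every value. *)
Fixpoint tri (j : nat) : nat := match j with O => O | S j => tri j + S j end.

(** A cell consists of a rise of [ramp n] steps, a plateau of [2 * ramp n] and a fall of
    [ramp n]. *)
Definition height (n t : nat) : R :=
  let u := (t mod cell n)%nat in
  Rmin 1 (Rmin (INR u / INR (ramp n)) (INR (cell n - u) / INR (ramp n))).
Definition phase (n t : nat) : nat := ((tri (t / cell n) + t) mod per n)%nat.

Definition proj (n : nat) (a : R * nat) : R * nat :=
  norm (fst a * height n (snd a), phase n (snd a)).
Definition rot (n k : nat) (a : R * nat) : R * nat :=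
  norm (fst a, ((snd a + k) mod per n)%nat).

Lemma phase_lt n t : (phase n t < per n)%nat.
Proof. apply Nat.mod_upper_bound. pose proof (per_gt0 n). lia. Qed.

Lemma height_bound n t : 0 <= height n t <= 1.
Proof.
  unfold height. split; [|apply Rmin_l].
  pose proof (ramp_pos n). apply Rmin_glb; [lra|].
  apply Rmin_glb; apply Rle_mult_inv_pos; auto using pos_INR.
Qed.

Lemma proj_spine n a : 0 <= fst a <= 1 -> spine (per n) (proj n a).
Proof.
  intros ha. unfold proj. apply spine_norm; [|apply phase_lt].
  pose proof (height_bound n (snd a)). nra.
Qed.

Lemma rot_spine n k a : 0 <= fst a <= 1 -> spine (per n) (rot n k a).
Proof.
  intros ha. unfold rot. apply spine_norm; auto. apply Nat.mod_upper_bound.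
  pose proof (per_gt0 n). lia.
Qed.

Lemma fst_proj n a : fst (proj n a) = fst a * height n (snd a).
Proof. apply fst_norm. Qed.

Lemma fst_rot n k a : fst (rot n k a) = fst a.
Proof. unfold rot. now rewrite fst_norm. Qed.

Lemma proj_lip n a b : 0 <= fst a -> 0 <= fst b -> hdist (proj n a) (proj n b) <= hdist a b.
Proof.
  intros ha hb. pose proof (height_bound n (snd a)). pose proof (height_bound n (snd b)).
  unfold proj. rewrite hdist_norm_l, hdist_norm_r; rewrite ?fst_norm; simpl; try nra.
  destruct a as [c s], b as [c' s']; simpl in *.
  destruct (Nat.eq_dec s s') as [<-|ne].
  - rewrite !hdist_same, <- Rmult_minus_distr_r, Rabs_mult, (Rabs_pos_eq (height n s)); [|lra].
    pose proof (Rabs_pos (c - c')). nra.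
  - eapply Rle_trans; [apply hdist_le_sum; simpl; nra|].
    unfold hdist; simpl. destruct Nat.eq_dec; [lia|]. nra.
Qed.

Lemma mod_eq_shift p s s' k : (s < p)%nat -> (s' < p)%nat ->
  ((s + k) mod p = (s' + k) mod p)%nat -> s = s'.
Proof.
  intros hs hs' e.
  pose proof (Nat.div_mod_eq (s + k) p). pose proof (Nat.div_mod_eq (s' + k) p).
  rewrite e in H. set (x := ((s + k) / p)%nat) in *. set (y := ((s' + k) / p)%nat) in *.
  destruct (Nat.lt_trichotomy x y) as [|[|]]; nia.
Qed.

Lemma rot_isom n k a b : spine (per n) a -> spine (per n) b ->
  hdist (rot n k a) (rot n k b) = hdist a b.
Proof.
  destruct a as [c s], b as [c' s']. intros (A1 & A2 & A3) (B1 & B2 & B3). simpl in *.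
  unfold rot; simpl. rewrite hdist_norm_l, hdist_norm_r; rewrite ?fst_norm; simpl; try lra.
  destruct (Nat.eq_dec s s') as [<-|ne]; [now rewrite !hdist_same|].
  unfold hdist; simpl. destruct (Nat.eq_dec s s'); [lia|].
  destruct Nat.eq_dec as [e|]; auto. now apply mod_eq_shift in e.
Qed.

Lemma rot_rot n j k a : rot n j (rot n k a) = rot n (k + j) a.
Proof.
  destruct a as [c s]. unfold rot at 2, norm; simpl. destruct Req_EM_T.
  - subst. unfold rot, norm; simpl. destruct Req_EM_T; [reflexivity|lra].
  - unfold rot; simpl. f_equal; f_equal.
    rewrite Nat.Div0.add_mod_idemp_l. f_equal. lia.
Qed.

Lemma rot_per n j a : spine (per n) a -> rot n (j * per n) a = a.
Proof.
  intros ha. unfold rot. rewrite Nat.Div0.mod_add.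
  rewrite Nat.mod_small by apply ha. rewrite <- (norm_spine _ _ ha) at 3. destruct a; reflexivity.
Qed.

Lemma rot_rotV n a : spine (per n) a -> rot n 1 (rot n (per n - 1) a) = a.
Proof.
  intros ha. rewrite rot_rot. replace (per n - 1 + 1)%nat with (1 * per n)%nat.
  now apply rot_per. pose proof (per_gt0 n). lia.
Qed.

Lemma mod_mod_mul t q k : ((t mod (q * k)) mod q = t mod q)%nat.
Proof.
  destruct (Nat.eq_dec q 0) as [->|]; [simpl; reflexivity|].
  rewrite Nat.Div0.mod_mul_r, (Nat.mul_comm q), Nat.Div0.mod_add, Nat.Div0.mod_mod. reflexivity.
Qed.

Lemma height_mod n t : height n (t mod per (S n)) = height n t.
Proof. unfold height. now rewrite per_S, mod_mod_mul. Qed.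

Lemma height_0 n t : (t mod cell n = 0)%nat -> height n t = 0.
Proof.
  intros e. unfold height. rewrite e. simpl. unfold Rdiv. rewrite Rmult_0_l.
  rewrite (Rmin_left 0), Rmin_right; try lra.
  apply Rle_mult_inv_pos; auto using pos_INR, ramp_pos.
Qed.

Lemma mod_S t q : (0 < q)%nat -> ((t + 1) mod q <> 0)%nat ->
  ((t + 1) mod q = t mod q + 1)%nat /\ ((t + 1) / q = t / q)%nat.
Proof.
  intros hq h.
  pose proof (Nat.div_mod_eq t q). pose proof (Nat.mod_upper_bound t q ltac:(lia)).
  assert (t mod q + 1 < q)%nat.
  { destruct (Nat.eq_dec (t mod q + 1) q); [|lia]. exfalso; apply h.
    replace (t + 1)%nat with ((t / q + 1) * q)%nat by nia. apply Nat.Div0.mod_mul. }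
  split.
  - symmetry; apply Nat.mod_unique with (t / q)%nat; lia.
  - symmetry; apply Nat.div_unique with (t mod q + 1)%nat; lia.
Qed.

Lemma mod_S0 t q : (0 < q)%nat -> ((t + 1) mod q = 0)%nat -> (t mod q + 1 = q)%nat.
Proof.
  intros hq h. pose proof (Nat.mod_upper_bound t q ltac:(lia)).
  destruct (Nat.eq_dec (t mod q + 1) q); auto. exfalso.
  pose proof (Nat.div_mod_eq t q).
  rewrite <- (Nat.mod_unique (t + 1) q (t / q) (t mod q + 1)) in h; lia.
Qed.

Lemma Rmin_lip x y x' y' e : Rabs (x - x') <= e -> Rabs (y - y') <= e ->
  Rabs (Rmin x y - Rmin x' y') <= e.
Proof. unfold Rmin, Rabs. repeat destruct Rcase_abs; repeat destruct Rle_dec; lra. Qed.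

Lemma cell_gt0 n : (0 < cell n)%nat.
Proof. unfold cell. pose proof (ramp_gt0 n). lia. Qed.

Lemma height_step n t : ((t + 1) mod cell n <> 0)%nat ->
  Rabs (height n (t + 1) - height n t) <= / INR (ramp n).
Proof.
  intros h. destruct (mod_S t _ (cell_gt0 n) h) as [e _].
  pose proof (Rinv_0_lt_compat _ (ramp_pos n)).
  pose proof (Nat.mod_upper_bound (t + 1) (cell n) ltac:(pose proof (cell_gt0 n); lia)).
  unfold height. rewrite e in *.
  apply Rmin_lip; [rewrite Rminus_diag, Rabs_R0; lra|].
  unfold Rdiv. rewrite !minus_INR, plus_INR by lia. simpl (INR 1).
  apply Rmin_lip; rewrite <- Rmult_minus_distr_r, Rabs_mult, (Rabs_pos_eq (/ _)) by lra.
  - replace (INR (t mod cell n) + 1 - INR (t mod cell n)) with 1 by ring.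
    rewrite Rabs_R1; lra.
  - match goal with |- Rabs ?x * _ <= _ => replace x with (-1) by ring end.
    rewrite Rabs_left; lra.
Qed.

Lemma height_last n t : ((t + 1) mod cell n = 0)%nat -> height n t <= / INR (ramp n).
Proof.
  intros h. apply mod_S0 in h; [|apply cell_gt0]. unfold height.
  replace (cell n - t mod cell n)%nat with 1%nat by lia.
  eapply Rle_trans; [apply Rmin_r|]. eapply Rle_trans; [apply Rmin_r|].
  simpl (INR 1). unfold Rdiv. lra.
Qed.

Lemma phase_step n t : ((t + 1) mod cell n <> 0)%nat ->
  phase n (t + 1) = ((phase n t + 1) mod per n)%nat.
Proof.
  intros h. destruct (mod_S t _ (cell_gt0 n) h) as [_ e].
  unfold phase. rewrite e, Nat.Div0.add_mod_idemp_l. f_equal. lia.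
Qed.

Lemma proj_0 n a : fst a = 0 -> proj n a = (0, 0%nat).
Proof. intros e. unfold proj, norm; simpl. rewrite e. destruct Req_EM_T; [easy|lra]. Qed.

Lemma rot_0 n k a : fst a = 0 -> rot n k a = (0, 0%nat).
Proof. intros e. unfold rot, norm; simpl. rewrite e. destruct Req_EM_T; [easy|lra]. Qed.

(* The phase map fails to commute with the rotations only at the ends of the
   cells, where the height vanishes. *)
Lemma proj_rot n a : spine (per (S n)) a ->
  hdist (proj n (rot (S n) 1 a)) (rot n 1 (proj n a)) <= / INR (ramp n).
Proof.
  destruct a as [c t]. intros (A1 & A2 & A3). cbn [fst snd] in *.
  pose proof (Rinv_0_lt_compat _ (ramp_pos n)).
  destruct (Req_EM_T c 0) as [c0|c0].
  { rewrite (rot_0 (S n)), (proj_0 n (0, 0%nat)), (proj_0 n (c, t)), rot_0, hdist_refl; simpl; auto; lra. }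
  assert (E : rot (S n) 1 (c, t) = (c, (t + 1) mod per (S n))%nat).
  { unfold rot, norm; cbn [fst snd]. destruct Req_EM_T; [easy|reflexivity]. }
  rewrite E. pose proof (height_bound n t) as hb.
  pose proof (height_bound n ((t + 1) mod per (S n))) as hb'.
  (* When t + 1 begins a new cell, one side is the hub and the other has amplitude at most
     [height n t], which is within one slope step of 0. *)
  destruct (Nat.eq_dec ((t + 1) mod cell n) 0) as [z|nz].
  - rewrite hdist_0l, fst_rot, fst_proj; cbn [fst snd].
    + pose proof (height_last n t z). nra.
    + rewrite fst_proj. cbn [fst snd]. rewrite height_mod, height_0; auto; lra.
    + rewrite fst_rot, fst_proj; cbn [fst snd]; nra.
  (* The rotation does not wrap around here, since [per (S n)] is a multiple of [cell n]. *)
  - assert (t + 1 < per (S n))%nat.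
    { destruct (Nat.eq_dec (t + 1) (per (S n))) as [e|]; [|lia]. exfalso; apply nz.
      rewrite e, per_S, Nat.mul_comm. apply Nat.Div0.mod_mul. }
    rewrite (Nat.mod_small (t + 1)) in * by auto.
    unfold proj at 1. rewrite hdist_norm_l by (rewrite fst_rot, fst_proj; simpl; nra).
    unfold rot. rewrite hdist_norm_r by (simpl; nra).
    unfold proj, norm; cbn [fst snd]. rewrite phase_step by auto.
    pose proof (height_step n t nz).
    destruct Req_EM_T as [e|ne]; cbn [fst snd].
    + rewrite (hdist_sym _), hdist_0l by (simpl; nra). cbn [fst].
      assert (height n t = 0) by (apply Rmult_integral in e; destruct e; [contradiction|auto]).
      rewrite H2, Rminus_0_r, Rabs_pos_eq in H1 by lra. nra.
    + rewrite hdist_same, <- Rmult_minus_distr_l, Rabs_mult, (Rabs_pos_eq c) by lra.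
      pose proof (Rabs_pos (height n (t + 1) - height n t)). nra.
Qed.

(** This is [proj_rot] at the point rotated backwards, transported by the isometry [rot n 1]. *)
Lemma proj_rotV n a : spine (per (S n)) a ->
  hdist (proj n (rot (S n) (per (S n) - 1) a)) (rot n (per n - 1) (proj n a)) <= / INR (ramp n).
Proof.
  intros ha. set (a' := rot (S n) (per (S n) - 1) a).
  assert (ha' : spine (per (S n)) a') by (apply rot_spine, ha).
  pose proof (proj_rot n _ ha') as h. unfold a' in h at 1. rewrite rot_rotV in h by auto.
  assert (hp : spine (per n) (proj n a)) by (apply proj_spine, ha).
  assert (hp' : spine (per n) (proj n a')) by (apply proj_spine, ha').
  rewrite <- (rot_isom n 1 (proj n a')) by (auto; apply rot_spine, hp).
  rewrite rot_rotV by auto. now rewrite hdist_sym.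
Qed.

(** * The inverse limit *)

Lemma hdist_small p a b : spine p a -> spine p b ->
  (forall e, 0 < e -> hdist a b <= e) -> a = b.
Proof.
  intros ha hb h. apply (hdist_eq0 p); auto. apply Rle_antisym.
  - apply le_epsilon. intros e he. specialize (h e he). lra.
  - apply hdist_ge0; [apply ha | apply hb].
Qed.

(** The amplitudes converge in R. If their limit is positive, late terms share one branch, because
    points of different branches are as far apart as the sum of their amplitudes. *)
Lemma spine_complete p (u : nat -> R * nat) : (forall i, spine p (u i)) ->
  (forall e, 0 < e -> exists K, forall i j, (K <= i)%nat -> (K <= j)%nat -> hdist (u i) (u j) <= e) ->
  exists y, spine p y /\
    forall e, 0 < e -> exists K, forall i, (K <= i)%nat -> hdist (u i) y <= e.
Proof.
  intros hu hc.
  assert (bd : forall i, 0 <= fst (u i) <= 1) by (intros; apply hu).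
  assert (C : Cauchy_crit (fun i => fst (u i))).
  { intros e he. destruct (hc (e / 2)) as [K hK]; [lra|]. exists K. intros i j hi hj.
    unfold Rdist. pose proof (hdist_fst (u i) (u j) (proj1 (bd i)) (proj1 (bd j))).
    specialize (hK i j hi hj). lra. }
  destruct (R_complete _ C) as [c hcv]. unfold Un_cv, Rdist in hcv.
  assert (c01 : 0 <= c <= 1).
  { split; apply le_epsilon; intros e he; destruct (hcv e he) as [K hK];
      specialize (hK K (le_n K)); apply Rabs_def2 in hK; specialize (bd K); lra. }
  destruct (Req_EM_T c 0) as [->|c0].
  - exists (0, 0%nat). split.
    { repeat split; simpl; try lra. specialize (hu 0%nat). destruct hu as (_ & h & _). lia. }
    intros e he. destruct (hcv e he) as [K hK]. exists K. intros i hi.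
    rewrite hdist_sym, hdist_0l; simpl; auto; [|apply bd].
    specialize (hK i hi). apply Rabs_def2 in hK. lra.
  - destruct (hc (c / 2)) as [K1 hK1]; [lra|].
    destruct (hcv (c / 2)) as [K2 hK2]; [lra|].
    set (K := Nat.max K1 K2).
    assert (same : forall i, (K <= i)%nat -> snd (u i) = snd (u K)).
    { intros i hi. specialize (hK1 i K ltac:(lia) ltac:(lia)). pose proof (hK2 i ltac:(lia)) as h.
      apply Rabs_def2 in h. unfold hdist in hK1. destruct Nat.eq_dec; auto.
      specialize (bd K). lra. }
    exists (c, snd (u K)). split.
    { repeat split; simpl; try lra. apply hu. }
    intros e he. destruct (hcv e he) as [K3 hK3]. exists (Nat.max K K3). intros i hi.
    rewrite <- (same i) by lia. rewrite (surjective_pairing (u i)) at 1. rewrite hdist_same.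
    apply Rlt_le, hK3. lia.
Qed.

(** The first index is the level, the second the factor of the power. Pinning the factors from m on
    to the hub replaces vectors of length m by plain functions. *)
Definition thread (m : nat) (x : nat -> nat -> R * nat) : Prop :=
  (forall n l, spine (per n) (x n l)) /\
  (forall n l, x n l = proj n (x (S n) l)) /\
  (forall n l, (m <= l)%nat -> x n l = (0, 0%nat)).

Definition pt (m : nat) : Type := { x | thread m x }.
Definition coord (m : nat) (x : pt m) : nat -> nat -> R * nat := proj1_sig x.
Coercion coord : pt >-> Funclass.

Section Space.
Variable m : nat.
Implicit Types x y z : pt m.

Lemma pt_spine x n l : spine (per n) (x n l).
Proof. apply (proj2_sig x). Qed.

Lemma pt_ge0 x n l : 0 <= fst (x n l).
Proof. apply pt_spine. Qed.

Lemma pt_le1 x n l : fst (x n l) <= 1.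
Proof. apply pt_spine. Qed.

#[local] Hint Resolve pt_spine pt_ge0 pt_le1 : core.

Lemma pt_proj x n l : x n l = proj n (x (S n) l).
Proof. apply (proj2_sig x). Qed.

Lemma pt_out x n l : (m <= l)%nat -> x n l = (0, 0%nat).
Proof. apply (proj2_sig x). Qed.

Lemma pt_ext x y : (forall n l, x n l = y n l) -> x = y.
Proof.
  destruct x as [f hf], y as [g hg]. unfold coord; simpl. intros h.
  assert (f = g) by (do 2 (apply functional_extensionality; intro); auto).
  subst. f_equal. apply proof_irrelevance.
Qed.

Lemma level_mono x y k n l : (k <= n)%nat -> hdist (x k l) (y k l) <= hdist (x n l) (y n l).
Proof.
  induction 1; [lra|]. eapply Rle_trans; [eassumption|].
  rewrite (pt_proj x m0), (pt_proj y m0). apply proj_lip; auto.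
Qed.

Lemma amp_mono x k n l : (k <= n)%nat -> fst (x k l) <= fst (x n l).
Proof.
  induction 1 as [|n]; [lra|]. eapply Rle_trans; [eassumption|].
  rewrite (pt_proj x n), fst_proj. pose proof (pt_ge0 x (S n) l).
  pose proof (height_bound n (snd (x (S n) l))). nra.
Qed.

(** Since [hdist] is at most 2, the weight 1 / (n + 1) makes high levels negligible, and a supremum
    suffices in place of a series. *)
Definition gaps x y (r : R) : Prop := exists n l, r = hdist (x n l) (y n l) / INR (S n).

Lemma hdist_le2 x y n l : 0 <= hdist (x n l) (y n l) <= 2.
Proof.
  split; [apply hdist_ge0; auto|]. eapply Rle_trans; [apply hdist_le_sum; auto|].
  pose proof (pt_le1 x n l). pose proof (pt_le1 y n l). lra.
Qed.

Lemma inv_S n : 0 < / INR (S n) <= 1.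
Proof.
  split; [apply Rinv_0_lt_compat, lt_0_INR; lia|].
  rewrite <- Rinv_1. apply Rinv_le_contravar; [lra|]. apply (le_INR 1). lia.
Qed.

Lemma gaps_bound x y : bound (gaps x y).
Proof.
  exists 2. intros r (n & l & ->). pose proof (hdist_le2 x y n l). pose proof (inv_S n).
  unfold Rdiv. nra.
Qed.

Lemma gaps_inhabited x y : exists r, gaps x y r.
Proof. eexists; exists 0%nat, 0%nat; reflexivity. Qed.

Definition dist x y : R :=
  proj1_sig (completeness (gaps x y) (gaps_bound x y) (gaps_inhabited x y)).

Lemma dist_ub x y n l : hdist (x n l) (y n l) / INR (S n) <= dist x y.
Proof.
  unfold dist. destruct completeness as [d hd]. simpl. apply hd. now exists n, l.
Qed.

Lemma dist_le x y e : (forall n l, hdist (x n l) (y n l) / INR (S n) <= e) -> dist x y <= e.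
Proof.
  intros h. unfold dist. destruct completeness as [d hd]. simpl. apply hd.
  intros r (n & l & ->). apply h.
Qed.

Lemma level_le_dist x y n l : hdist (x n l) (y n l) <= INR (S n) * dist x y.
Proof.
  pose proof (dist_ub x y n l) as h. assert (0 < INR (S n)) by (apply lt_0_INR; lia).
  apply (Rmult_le_compat_l (INR (S n))) in h; [|lra].
  unfold Rdiv in h. rewrite <- Rmult_assoc, (Rmult_comm (INR (S n))), Rmult_assoc, Rinv_r in h; lra.
Qed.

(** Levels up to n are controlled by level n, the bonding maps being 1-Lipschitz; higher levels are
    controlled by their weight. *)
Lemma dist_le_level x y n e : (forall l, (l < m)%nat -> hdist (x n l) (y n l) <= e) ->
  0 <= e -> 2 / INR (S n) <= e -> dist x y <= e.
Proof.
  intros h e0 he. apply dist_le. intros k l.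
  pose proof (hdist_le2 x y k l). pose proof (inv_S k).
  destruct (Nat.lt_ge_cases l m) as [hl|hl].
  2:{ rewrite !pt_out, hdist_refl by auto. unfold Rdiv. lra. }
  destruct (Nat.le_gt_cases k n) as [hk|hk].
  - pose proof (level_mono x y k n l hk). specialize (h l hl). unfold Rdiv. nra.
  - eapply Rle_trans; [|exact he]. unfold Rdiv.
    assert (/ INR (S k) <= / INR (S n)).
    { apply Rinv_le_contravar; [apply lt_0_INR; lia|apply le_INR; lia]. }
    nra.
Qed.

Lemma inv_S_small e : 0 < e -> exists n, 2 / INR (S n) < e.
Proof.
  intros he. destruct (archimed_cor1 (e / 2)) as [n [h1 h2]]; [lra|].
  exists n. assert (/ INR (S n) <= / INR n).
  { apply Rinv_le_contravar; [now apply lt_0_INR|]. apply le_INR. lia. }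
  unfold Rdiv. lra.
Qed.

Lemma dist_metric : is_metric dist.
Proof.
  repeat split.
  - intros x y. eapply Rle_trans; [|apply (dist_ub x y 0 0)].
    pose proof (hdist_le2 x y 0 0). simpl. lra.
  - intros h. apply pt_ext. intros n l. apply (hdist_small (per n)); auto. intros e he.
    pose proof (level_le_dist x y n l) as hl. rewrite h, Rmult_0_r in hl. lra.
  - intros ->. apply Rle_antisym.
    + apply dist_le. intros. rewrite hdist_refl. unfold Rdiv. lra.
    + eapply Rle_trans; [|apply (dist_ub y y 0 0)]. rewrite hdist_refl. unfold Rdiv. lra.
  - intros x y. apply Rle_antisym; apply dist_le; intros; rewrite hdist_sym; apply dist_ub.
  - intros x y z. apply dist_le. intros n l.
    pose proof (dist_ub x y n l). pose proof (dist_ub y z n l). pose proof (inv_S n).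
    assert (hdist (x n l) (z n l) <= hdist (x n l) (y n l) + hdist (y n l) (z n l))
      by (apply hdist_tri; auto).
    unfold Rdiv in *. nra.
Qed.

Lemma levelwise_complete (u : nat -> pt m) :
  (forall n l e, 0 < e -> exists K, forall i j, (K <= i)%nat -> (K <= j)%nat ->
     hdist (u i n l) (u j n l) <= e) ->
  exists y : pt m, forall n l e, 0 < e -> exists K, forall i, (K <= i)%nat ->
    hdist (u i n l) (y n l) <= e.
Proof.
  intros hc.
  assert (ex : forall nl : nat * nat, exists a, spine (per (fst nl)) a /\
    forall e, 0 < e -> exists K, forall i, (K <= i)%nat ->
      hdist (u i (fst nl) (snd nl)) a <= e).
  { intros [n l]. apply spine_complete; simpl; auto. }
  apply choice in ex. destruct ex as [f hf].
  assert (th : thread m (fun n l => f (n, l))).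
  { split; [|split].
    - intros n l. apply (hf (n, l)).
    - intros n l. destruct (hf (n, l)) as [s1 c1], (hf (S n, l)) as [s2 c2]. simpl in *.
      apply (hdist_small (per n)); auto; [apply proj_spine, s2|].
      intros e he. destruct (c1 (e / 2)) as [K1 h1]; [lra|].
      destruct (c2 (e / 2)) as [K2 h2]; [lra|].
      set (i := Nat.max K1 K2). specialize (h1 i ltac:(lia)). specialize (h2 i ltac:(lia)).
      assert (hdist (u i n l) (proj n (f (S n, l))) <= e / 2).
      { rewrite pt_proj. eapply Rle_trans; [apply proj_lip; auto; apply s2|exact h2]. }
      rewrite hdist_sym in h1.
      eapply Rle_trans; [apply (hdist_tri _ (u i n l)); auto; [apply s1|]|lra].
      rewrite fst_proj. pose proof (height_bound n (snd (f (S n, l)))).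
      destruct s2 as [[s2 _] _]. nra.
    - intros n l hl. destruct (hf (n, l)) as [s1 c1]. simpl in *.
      apply (hdist_small (per n)); auto.
      { repeat split; simpl; try lra; auto. apply per_gt0. }
      intros e he. destruct (c1 e he) as [K h]. specialize (h K (le_n K)).
      rewrite pt_out in h by auto. now rewrite hdist_sym. }
  exists (exist _ _ th). intros n l. apply (hf (n, l)).
Qed.

(** * Sections of the bonding maps and points with a prescribed level *)

Fixpoint down (n j : nat) (a : R * nat) : R * nat :=
  match j with O => a | S j => proj n (down (S n) j a) end.

(** Moves the phase onto the plateau of the first cell. There the height is 1, the shift [tri 0] is
    0 and [ramp n] is a multiple of [per n], so [proj] undoes it. *)
Definition sec (n : nat) (a : R * nat) : R * nat := norm (fst a, (ramp n + snd a)%nat).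

Fixpoint up (n j : nat) (a : R * nat) : R * nat :=
  match j with O => a | S j => sec (n + j) (up n j a) end.

Lemma height_plateau n j r : (r < per n)%nat -> height n (j * cell n + (ramp n + r)) = 1.
Proof.
  intros hr. pose proof (per_le_ramp n). pose proof (ramp_gt0 n). pose proof (ramp_pos n) as hp.
  unfold height. rewrite Nat.add_comm, Nat.Div0.mod_add.
  rewrite (Nat.mod_small (ramp n + r)) by (unfold cell; lia).
  assert (g : forall k, (ramp n <= k)%nat -> 1 <= INR k / INR (ramp n)).
  { intros k hk. apply Rmult_le_reg_r with (INR (ramp n)); auto.
    unfold Rdiv. rewrite Rmult_assoc, Rinv_l, Rmult_1_l, Rmult_1_r by lra. now apply le_INR. }
  apply Rmin_left. apply Rmin_glb; apply g; unfold cell; lia.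
Qed.

Lemma phase_plateau n j r : (r < per n)%nat ->
  phase n (j * cell n + (ramp n + r)) = ((tri j + r) mod per n)%nat.
Proof.
  intros hr. pose proof (per_le_ramp n). pose proof (ramp_gt0 n).
  unfold phase. rewrite Nat.div_add_l by (pose proof (cell_gt0 n); lia).
  rewrite (Nat.div_small (ramp n + r)) by (unfold cell; lia).
  replace (tri (j + 0) + (j * cell n + (ramp n + r)))%nat
    with (tri j + r + (j * 4 * S n + S n) * per n)%nat.
  - apply Nat.Div0.mod_add.
  - rewrite Nat.add_0_r. unfold cell, ramp. nia.
Qed.

Lemma sec_lt n s : (s < per n)%nat -> (ramp n + s < per (S n))%nat.
Proof.
  intros. pose proof (per_le_ramp n). rewrite per_S. unfold cell. nia.
Qed.

Lemma sec_spine n a : spine (per n) a -> spine (per (S n)) (sec n a).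
Proof. intros (h1 & h2 & h3). apply spine_norm; auto. now apply sec_lt. Qed.

Lemma proj_sec n a : spine (per n) a -> proj n (sec n a) = a.
Proof.
  intros ha. pose proof ha as (h1 & h2 & h3). destruct a as [c s]. simpl in *.
  unfold sec, norm; simpl. destruct Req_EM_T as [e|ne].
  - rewrite proj_0 by easy. rewrite h3 by auto. now rewrite e.
  - unfold proj; cbn [fst snd].
    pose proof (height_plateau n 0 s h2) as hp. pose proof (phase_plateau n 0 s h2) as pp.
    simpl in hp, pp. rewrite hp, pp, Rmult_1_r, Nat.mod_small by auto.
    now apply norm_spine with (per n).
Qed.

Lemma sec_lip n a b : 0 <= fst a -> 0 <= fst b -> hdist (sec n a) (sec n b) <= hdist a b.
Proof.
  intros ha hb. unfold sec. rewrite hdist_norm_l, hdist_norm_r by (rewrite ?fst_norm; auto).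
  destruct a as [c s], b as [c' s']; simpl in *.
  unfold hdist; simpl. repeat destruct Nat.eq_dec; try lia; lra.
Qed.

Lemma down_spine n j a : spine (per (n + j)) a -> spine (per n) (down n j a).
Proof.
  revert n a; induction j as [|j IH]; simpl; intros n a h.
  - now rewrite Nat.add_0_r in h.
  - apply proj_spine. apply (IH (S n)). now rewrite <- plus_n_Sm in h.
Qed.

Lemma down_S n j a : down n (S j) a = down n j (proj (n + j) a).
Proof.
  revert n a; induction j as [|j IH]; intros n a.
  - simpl. now rewrite Nat.add_0_r.
  - change (proj n (down (S n) (S j) a) = proj n (down (S n) j (proj (n + S j) a))).
    now rewrite IH, <- plus_n_Sm.
Qed.

Lemma up_spine n j a : spine (per n) a -> spine (per (n + j)) (up n j a).
Proof.
  intros h; induction j as [|j IH]; simpl; [now rewrite Nat.add_0_r|].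
  rewrite <- plus_n_Sm. now apply sec_spine.
Qed.

Lemma up_lip n j a b : spine (per n) a -> spine (per n) b ->
  hdist (up n j a) (up n j b) <= hdist a b.
Proof.
  intros ha hb; induction j as [|j IH]; simpl; [lra|].
  eapply Rle_trans; [apply sec_lip|exact IH]; apply up_spine; auto.
Qed.

Lemma down_up n j a : spine (per n) a -> down n j (up n j a) = a.
Proof.
  intros ha. induction j as [|j IH]; [reflexivity|].
  rewrite down_S. simpl up. rewrite proj_sec; auto. now apply up_spine.
Qed.

Lemma spine_00 n : spine (per n) (0, 0%nat).
Proof. repeat split; simpl; try lra; auto using per_gt0. Qed.

Lemma proj_00 n : proj n (0, 0%nat) = (0, 0%nat).
Proof. now apply proj_0. Qed.

Lemma down_00 n j : down n j (0, 0%nat) = (0, 0%nat).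
Proof. revert n; induction j; simpl; intros; auto. now rewrite IHj, proj_00. Qed.

Lemma up_00 n j : up n j (0, 0%nat) = (0, 0%nat).
Proof.
  induction j; simpl; auto. rewrite IHj. unfold sec, norm; simpl.
  destruct Req_EM_T; [easy|lra].
Qed.

(** One formula covers all levels without comparing n and N: climb n levels from N by sections, then
    descend N levels to n. *)
Lemma lift_thread N (v : nat -> R * nat) :
  (forall l, spine (per N) (v l)) -> (forall l, (m <= l)%nat -> v l = (0, 0%nat)) ->
  thread m (fun n l => down n N (up N n (v l))).
Proof.
  intros hs ho. split; [|split].
  - intros n l. apply down_spine. rewrite Nat.add_comm. now apply up_spine.
  - intros n l. change (down n N (up N n (v l)) = down n (S N) (up N (S n) (v l))).
    rewrite down_S. simpl up. rewrite Nat.add_comm, proj_sec; auto. now apply up_spine.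
  - intros n l hl. now rewrite ho, up_00, down_00.
Qed.

Lemma lift N (v : nat -> R * nat) :
  (forall l, spine (per N) (v l)) -> (forall l, (m <= l)%nat -> v l = (0, 0%nat)) ->
  exists x : pt m, forall l, x N l = v l.
Proof.
  intros hs ho. exists (exist _ _ (lift_thread N v hs ho)). intros l. now apply down_up.
Qed.

End Space.

(** * The homeomorphism *)

#[global] Hint Resolve pt_spine pt_ge0 pt_le1 : core.

(** Bounds the sum of 1 / [ramp k] over all k from n on, because [ramp] at least doubles at each
    level. *)
Definition eta (n : nat) : R := 2 / INR (ramp n).

Lemma eta_pos n : 0 < eta n.
Proof. unfold eta, Rdiv. pose proof (Rinv_0_lt_compat _ (ramp_pos n)). lra. Qed.

Lemma eta_S n : / INR (ramp n) + eta (S n) <= eta n.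
Proof.
  unfold eta, Rdiv. pose proof (ramp_pos n).
  assert (/ INR (ramp (S n)) <= / (2 * INR (ramp n))).
  { apply Rinv_le_contravar; [lra|]. pose proof (le_INR _ _ (ramp_double n)) as h.
    rewrite mult_INR in h. simpl (INR 2) in h. lra. }
  rewrite Rinv_mult in H0. lra.
Qed.

Lemma per_eta n : INR (per n) * eta n = 2 / INR (S n).
Proof.
  unfold eta, ramp. rewrite mult_INR. field.
  split; apply not_0_INR; [lia|]. pose proof (per_gt0 n). lia.
Qed.

Lemma eta_mult n k : (k <= per n)%nat -> INR k * eta n <= 2 / INR (S n).
Proof.
  intros h. rewrite <- per_eta. apply Rmult_le_compat_r; [|now apply le_INR].
  pose proof (eta_pos n); lra.
Qed.

Lemma eta_le n : eta n <= 2 / INR (S n).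
Proof.
  rewrite <- (Rmult_1_l (eta n)). apply (eta_mult n 1). apply per_gt0.
Qed.

Lemma frac_mono k n : (k <= n)%nat -> 2 / INR (S n) <= 2 / INR (S k).
Proof.
  intros. unfold Rdiv. apply Rmult_le_compat_l; [lra|].
  apply Rinv_le_contravar; [apply lt_0_INR; lia|apply le_INR; lia].
Qed.

Lemma frac_pos n : 0 < 2 / INR (S n).
Proof. unfold Rdiv. pose proof (inv_S n). lra. Qed.

Section Dynamics.
Variable m : nat.
Implicit Types x y z : pt m.

(** Stated for any rotation amounts that almost commute with [proj], so that it yields both the map
    (amount 1) and its inverse (amount [per n - 1]). The point y is the limit of points whose level
    N is exactly the rotated level N of x. *)
Lemma shadow (k : nat -> nat) :
  (forall n a, spine (per (S n)) a ->
     hdist (proj n (rot (S n) (k (S n)) a)) (rot n (k n) (proj n a)) <= / INR (ramp n)) ->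
  forall x, exists y, forall n l, hdist (y n l) (rot n (k n) (x n l)) <= eta n.
Proof.
  intros hk x.
  assert (ex : forall N, exists z, forall l, z N l = rot N (k N) (x N l)).
  { intros N. apply lift.
    - intros l. apply rot_spine. split; auto.
    - intros l hl. rewrite pt_out; auto. now apply rot_0. }
  apply choice in ex. destruct ex as [z hz].
  assert (hrot : forall n l, spine (per n) (rot n (k n) (x n l))).
  { intros. apply rot_spine. split; auto. }
  assert (hrot0 : forall n l, 0 <= fst (rot n (k n) (x n l))) by (intros; apply hrot).
  (* Each descent from level n + 1 to n costs 1 / [ramp n]; differences of [eta] make these costs
     telescope. *)
  assert (est : forall d n l, hdist (z (n + d)%nat n l) (rot n (k n) (x n l)) <= eta n - eta (n + d)).
  { induction d as [|d IH]; intros n l.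
    - rewrite Nat.add_0_r, hz, hdist_refl. lra.
    - specialize (IH (S n) l). replace (S n + d)%nat with (n + S d)%nat in IH by lia.
      pose proof (hk n _ (pt_spine m x (S n) l)) as h.
      rewrite <- pt_proj in h. rewrite pt_proj.
      pose proof (eta_S n).
      eapply Rle_trans; [apply (hdist_tri _ (proj n (rot (S n) (k (S n)) (x (S n) l))))|].
      + apply proj_spine. split; auto.
      + apply proj_spine, hrot.
      + auto.
      + assert (hdist (proj n (z (n + S d)%nat (S n) l))
                  (proj n (rot (S n) (k (S n)) (x (S n) l))) <= eta (S n) - eta (n + S d))
          by (eapply Rle_trans; [apply proj_lip; auto|exact IH]).
        lra. }
  assert (est' : forall n N l, (n <= N)%nat -> hdist (z N n l) (rot n (k n) (x n l)) <= eta n).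
  { intros n N l h. specialize (est (N - n)%nat n l). replace (n + (N - n))%nat with N in est by lia.
    pose proof (eta_pos N). lra. }
  destruct (levelwise_complete m z) as [y hy].
  - intros n l e he. destruct (inv_S_small (e / 2)) as [K0 hK]; [lra|].
    set (K := Nat.max n K0). exists K. intros i j hi hj.
    eapply Rle_trans; [apply (level_mono m _ _ n K); lia|].
    pose proof (est' K i l hi). pose proof (est' K j l hj). rewrite hdist_sym in H0.
    pose proof (eta_le K). pose proof (frac_mono K0 K ltac:(lia)).
    eapply Rle_trans; [apply (hdist_tri _ (rot K (k K) (x K l))); auto|lra].
  - exists y. intros n l. apply le_epsilon. intros e he.
    destruct (hy n l e he) as [K hK]. specialize (hK (Nat.max n K) ltac:(lia)).
    pose proof (est' n (Nat.max n K) l ltac:(lia)). rewrite hdist_sym in hK.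
    eapply Rle_trans; [apply (hdist_tri _ (z (Nat.max n K) n l)); auto|lra].
Qed.

(** As [eta n] tends to 0, each of x and y determines the other. The relation is therefore the graph
    of a bijection, whichever limits [shadow] provides. *)
Definition step x y : Prop := forall n l, hdist (y n l) (rot n 1 (x n l)) <= eta n.

Lemma step_total x : exists y, step x y.
Proof. apply (shadow (fun _ => 1%nat)). apply proj_rot. Qed.

Lemma rot_pt_spine x n k l : spine (per n) (rot n k (x n l)).
Proof. apply rot_spine. split; auto. Qed.

Lemma rot_pt_ge0 x n k l : 0 <= fst (rot n k (x n l)).
Proof. apply rot_pt_spine. Qed.

#[local] Hint Resolve rot_pt_spine rot_pt_ge0 : core.

Lemma step_surj y : exists x, step x y.
Proof.
  destruct (shadow (fun n => per n - 1)%nat proj_rotV y) as [x hx].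
  exists x. intros n l. specialize (hx n l). rewrite hdist_sym.
  rewrite <- (rot_rotV n (y n l)), rot_isom; auto.
Qed.

Lemma step_fwd x y x' y' n l : step x y -> step x' y' ->
  hdist (y n l) (y' n l) <= 2 * eta n + hdist (x n l) (x' n l).
Proof.
  intros h h'. specialize (h n l). specialize (h' n l). rewrite hdist_sym in h'.
  rewrite <- (rot_isom n 1 (x n l)) by auto.
  pose proof (hdist_tri (y n l) (rot n 1 (x n l)) (y' n l)).
  pose proof (hdist_tri (rot n 1 (x n l)) (rot n 1 (x' n l)) (y' n l)).
  pose proof (rot_pt_ge0 x n 1 l). pose proof (rot_pt_ge0 x' n 1 l).
  pose proof (pt_ge0 m y n l). pose proof (pt_ge0 m y' n l).
  specialize (H H3 H1 H4). specialize (H0 H1 H2 H4). lra.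
Qed.

Lemma step_bwd x y x' y' n l : step x y -> step x' y' ->
  hdist (x n l) (x' n l) <= 2 * eta n + hdist (y n l) (y' n l).
Proof.
  intros h h'. specialize (h n l). specialize (h' n l). rewrite hdist_sym in h.
  rewrite <- (rot_isom n 1 (x n l)) by auto.
  pose proof (hdist_tri (rot n 1 (x n l)) (y n l) (rot n 1 (x' n l))).
  pose proof (hdist_tri (y n l) (y' n l) (rot n 1 (x' n l))).
  pose proof (rot_pt_ge0 x n 1 l). pose proof (rot_pt_ge0 x' n 1 l).
  pose proof (pt_ge0 m y n l). pose proof (pt_ge0 m y' n l).
  specialize (H H1 H3 H2). specialize (H0 H3 H4 H2). lra.
Qed.

Lemma quasi_isom_eq x x' :
  (forall n l, hdist (x n l) (x' n l) <= 2 * eta n) -> x = x'.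
Proof.
  intros h. apply pt_ext. intros n l. apply (hdist_small (per n)); auto. intros e he.
  destruct (inv_S_small (e / 2)) as [K0 hK]; [lra|]. set (K := Nat.max n K0).
  pose proof (level_mono m x x' n K l ltac:(lia)). specialize (h K l).
  pose proof (eta_le K). pose proof (frac_mono K0 K ltac:(lia)). lra.
Qed.

Lemma quasi_isom_continuous (F : pt m -> pt m) :
  (forall x x' n l, hdist (F x n l) (F x' n l) <= 2 * eta n + hdist (x n l) (x' n l)) ->
  continuous (dist m) F.
Proof.
  intros hF x e he. destruct (inv_S_small (e / 8)) as [n hn]; [lra|].
  assert (0 < INR (S n)) by (apply lt_0_INR; lia).
  exists (e / 8 / INR (S n)). split.
  { apply Rdiv_lt_0_compat; lra. }
  intros y hy. apply Rle_lt_trans with (e / 2); [|lra].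
  apply (dist_le_level m _ _ n); try lra.
  intros l _. eapply Rle_trans; [apply hF|].
  pose proof (level_le_dist m x y n l). pose proof (eta_le n).
  apply (Rmult_lt_compat_l (INR (S n))) in hy; [|lra].
  replace (INR (S n) * (e / 8 / INR (S n))) with (e / 8) in hy by (field; lra). lra.
Qed.

Definition next x : pt m :=
  proj1_sig (constructive_indefinite_description _ (step_total x)).

Definition prev y : pt m :=
  proj1_sig (constructive_indefinite_description _ (step_surj y)).

Lemma step_next x : step x (next x).
Proof. apply (proj2_sig (constructive_indefinite_description _ (step_total x))). Qed.

Lemma step_prev y : step (prev y) y.
Proof. apply (proj2_sig (constructive_indefinite_description _ (step_surj y))). Qed.

Lemma next_homeo : homeomorphism (dist m) next.
Proof.
  split; [|exists prev; repeat split].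
  - apply quasi_isom_continuous. intros. apply step_fwd; apply step_next.
  - apply quasi_isom_continuous. intros. apply step_bwd; apply step_prev.
  - intros x. apply quasi_isom_eq. intros n l.
    pose proof (step_bwd _ _ _ _ n l (step_prev (next x)) (step_next x)) as h.
    rewrite hdist_refl in h. lra.
  - intros x. apply quasi_isom_eq. intros n l.
    pose proof (step_fwd _ _ _ _ n l (step_next (prev x)) (step_prev x)) as h.
    rewrite hdist_refl in h. lra.
Qed.

Notation iter k x := (Nat.iter k next x).

Lemma iter_rot k x n l : hdist (iter k x n l) (rot n k (x n l)) <= INR k * eta n.
Proof.
  induction k as [|k IH].
  - pose proof (rot_per n 0 _ (pt_spine m x n l)) as h. simpl in h. simpl Nat.iter.
    rewrite h, hdist_refl. simpl. lra.
  - replace (S k) with (k + 1)%nat by lia. rewrite <- rot_rot, plus_INR. simpl (INR 1).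
    replace (k + 1)%nat with (S k) by lia. simpl Nat.iter.
    pose proof (step_next (iter k x) n l) as h.
    pose proof (rot_isom n 1 (iter k x n l) (rot n k (x n l)) ltac:(auto) ltac:(auto)).
    pose proof (hdist_tri (next (iter k x) n l) (rot n 1 (iter k x n l))
      (rot n 1 (rot n k (x n l))) ltac:(auto) ltac:(auto)).
    assert (0 <= fst (rot n 1 (rot n k (x n l)))) by (rewrite fst_rot; auto).
    specialize (H0 H1). lra.
Qed.

Lemma iter_per x n : dist m (iter (per n) x) x <= 2 / INR (S n).
Proof.
  apply (dist_le_level m _ _ n).
  - intros l _. pose proof (iter_rot (per n) x n l) as h.
    pose proof (rot_per n 1 _ (pt_spine m x n l)) as e. rewrite Nat.mul_1_l in e.
    rewrite e in h. eapply Rle_trans; [exact h|]. now apply eta_mult.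
  - apply Rlt_le, frac_pos.
  - lra.
Qed.

Lemma next_not_asymptotic x y : x <> y -> ~ asymptotic (dist m) next x y.
Proof.
  intros ne as_. apply ne. destruct (dist_metric m) as (_ & d0 & ds & dt).
  apply d0. apply Rle_antisym; [|apply (dist_metric m)].
  apply le_epsilon. intros e he. destruct (as_ (e / 3)) as [N hN]; [lra|].
  destruct (inv_S_small (e / 3)) as [n0 hn]; [lra|]. set (n := Nat.max N n0).
  specialize (hN (per n)). pose proof (per_ge n). specialize (hN ltac:(lia)).
  pose proof (frac_mono n0 n ltac:(lia)).
  pose proof (iter_per x n) as hx. pose proof (iter_per y n) as hy. rewrite ds in hx.
  pose proof (dt x (iter (per n) x) y). pose proof (dt (iter (per n) x) (iter (per n) y) y). lra.
Qed.

Lemma amp_drift k x n l : Rabs (fst (iter k x n l) - fst (x n l)) <= INR k * eta n.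
Proof.
  pose proof (iter_rot k x n l) as h.
  pose proof (hdist_fst _ _ (pt_ge0 m (iter k x) n l) (rot_pt_ge0 x n k l)) as h'.
  rewrite fst_rot in h'. lra.
Qed.

(** At level n + 1, rotating k times brings the phase to the end of its cell, where [height n]
    vanishes. As k is at most [per (S n)], the orbit follows this rotation up to 2 / (n + 2). *)
Lemma low_visit x n l : exists k, (k <= cell n)%nat /\ fst (iter k x n l) <= 2 / INR (S (S n)).
Proof.
  set (a := x (S n) l). set (q := cell n).
  pose proof (cell_gt0 n) as hq. fold q in hq.
  pose proof (Nat.mod_upper_bound (snd a) q ltac:(lia)) as hm.
  exists (q - snd a mod q)%nat. set (k := (q - snd a mod q)%nat). split; [lia|].
  pose proof (iter_rot k x (S n) l) as h. fold a in h.
  pose proof (proj_lip n _ _ (pt_ge0 m (iter k x) (S n) l) (rot_pt_ge0 x (S n) k l)) as h1.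
  rewrite <- pt_proj in h1. fold a in h1.
  assert (E : fst (proj n (rot (S n) k a)) = 0).
  { rewrite fst_proj. unfold rot, norm; cbn [fst snd].
    destruct Req_EM_T as [e|ne]; cbn [fst snd]; [lra|].
    rewrite height_mod, height_0; [lra|].
    pose proof (Nat.div_mod_eq (snd a) q). fold q. unfold k.
    replace (snd a + (q - snd a mod q))%nat with ((snd a / q + 1) * q)%nat by nia.
    apply Nat.Div0.mod_mul. }
  rewrite hdist_sym, hdist_0l in h1; auto.
  pose proof (cell_le_per n). pose proof (eta_mult (S n) k ltac:(lia)). lra.
Qed.

(* A low visit of one coordinate happens within one cell of level [n]; during that
   time coordinates that are low at a much higher level stay low. *)
Lemma common_low_visit (L : list (pt m * nat)) : forall n e N, 0 < e ->
  exists k, (N <= k)%nat /\ forall x l, In (x, l) L -> fst (iter k x n l) <= e.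
Proof.
  induction L as [|[x l] L IH]; intros n e N he.
  - exists N. split; [lia|]. intros x l [].
  - destruct (inv_S_small (e / 2)) as [n0 hn0]; [lra|]. set (n1 := Nat.max n n0).
    destruct (IH (S n1) (e / 2) N ltac:(lra)) as [k0 [hk0 hL]].
    destruct (low_visit (iter k0 x) n1 l) as [k1 [hk1 hx]].
    exists (k1 + k0)%nat. split; [lia|]. intros y j [E|hin].
    + inversion E; subst y j. rewrite Nat.iter_add.
      eapply Rle_trans; [apply (amp_mono m _ n n1); lia|].
      pose proof (frac_mono n0 (S n1) ltac:(lia)). lra.
    + rewrite Nat.iter_add. specialize (hL y j hin).
      eapply Rle_trans; [apply (amp_mono m _ n (S n1)); lia|].
      pose proof (amp_drift k1 (iter k0 y) (S n1) j) as hd.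
      pose proof (cell_le_per n1). pose proof (eta_mult (S n1) k1 ltac:(lia)).
      pose proof (frac_mono n0 (S n1) ltac:(lia)).
      pose proof (Rle_abs (fst (iter k1 (iter k0 y) (S n1) j) - fst (iter k0 y (S n1) j))). lra.
Qed.

Lemma next_proximal x y : proximal (dist m) next x y.
Proof.
  intros e he N. destruct (inv_S_small (e / 2)) as [n hn]; [lra|].
  destruct (common_low_visit (map (pair x) (seq 0 m) ++ map (pair y) (seq 0 m)) n (e / 4) N)
    as [k [hk hlow]]; [lra|].
  exists k. split; auto. apply Rle_lt_trans with (e / 2); [|lra].
  apply (dist_le_level m _ _ n); try lra. intros l hl.
  eapply Rle_trans; [apply hdist_le_sum; auto|].
  assert (In l (seq 0 m)) by (apply in_seq; lia).
  pose proof (hlow x l ltac:(apply in_or_app; left; now apply in_map)).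
  pose proof (hlow y l ltac:(apply in_or_app; right; now apply in_map)). lra.
Qed.

Lemma next_scrambled : completely_scrambled (dist m) next.
Proof. intros x y ne. split; [apply next_proximal|now apply next_not_asymptotic]. Qed.

End Dynamics.

(** * Weak mixing *)

Definition nfloor (r : R) : nat := Z.to_nat (Int_part r).

Lemma nfloor_spec r : 0 <= r -> INR (nfloor r) <= r < INR (nfloor r) + 1.
Proof.
  intros h. unfold nfloor. destruct (base_Int_part r) as [h1 h2].
  assert (0 <= Int_part r)%Z.
  { assert (IZR (-1) < IZR (Int_part r)) by lra. apply lt_IZR in H. lia. }
  rewrite INR_IZR_INZ, Z2Nat.id by auto. lra.
Qed.

(** On the rise of the first cell, a run through all phases raises the height by only [per n] /
    [ramp n] = 1 / (n + 1), so every phase occurs near every height. Hence points of amplitude 1 one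
    level up suffice to approximate level n. *)
Lemma proj_dense n c s : 0 <= c <= 1 -> (s < per n)%nat ->
  exists t, (t < cell n)%nat /\ phase n t = s /\ Rabs (height n t - c) <= / INR (S n).
Proof.
  intros hc hs. assert (hS : 0 < INR (S n)) by (apply lt_0_INR; lia).
  destruct (nfloor_spec (c * INR (S n))) as [h1 h2]; [nra|].
  set (j := nfloor (c * INR (S n))) in *.
  assert (hj : (j <= S n)%nat) by (apply INR_le; nra).
  pose proof (per_gt0 n) as hp. pose proof (ramp_pos n) as hr.
  (* j full runs of the phases reach a height at most 1 / (n + 1) below c; s further steps set the
     phase. *)
  exists (j * per n + s)%nat.
  assert (lt2 : (j * per n + s < 2 * ramp n)%nat) by (unfold ramp; nia).
  assert (ltc : (j * per n + s < cell n)%nat) by (unfold cell; lia).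
  split; [exact ltc|split].
  - unfold phase. rewrite Nat.div_small by auto. simpl tri. rewrite Nat.add_0_l, Nat.add_comm.
    rewrite Nat.Div0.mod_add. now apply Nat.mod_small.
  - unfold height. rewrite Nat.mod_small by auto. set (t := (j * per n + s)%nat) in *.
    assert (p0 : 0 < INR (per n)) by (now apply lt_0_INR).
    assert (E : INR t / INR (ramp n) = INR j / INR (S n) + INR s / INR (per n) * / INR (S n)).
    { unfold t, ramp. rewrite plus_INR, !mult_INR. field. lra. }
    assert (s01 : 0 <= INR s / INR (per n) <= 1).
    { split; [apply Rle_mult_inv_pos; auto using pos_INR|].
      apply Rmult_le_reg_r with (INR (per n)); auto. unfold Rdiv.
      rewrite Rmult_assoc, Rinv_l, Rmult_1_l, Rmult_1_r by lra. apply le_INR; lia. }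
    assert (j01 : c - / INR (S n) <= INR j / INR (S n) <= c).
    { split; apply Rmult_le_reg_r with (INR (S n)); auto; unfold Rdiv;
        rewrite ?Rmult_minus_distr_r, ?Rmult_assoc, Rinv_l by lra; lra. }
    pose proof (Rinv_0_lt_compat _ hS) as hi.
    assert (1 <= INR (cell n - t) / INR (ramp n)).
    { apply Rmult_le_reg_r with (INR (ramp n)); auto. unfold Rdiv.
      rewrite Rmult_assoc, Rinv_l, Rmult_1_l, Rmult_1_r by lra. apply le_INR.
      unfold cell in *; lia. }
    rewrite E in *. set (w := INR s / INR (per n)) in *. set (v := INR j / INR (S n)) in *.
    assert (0 <= w * / INR (S n) <= / INR (S n)) by nra.
    unfold Rmin. repeat destruct Rle_dec; apply Rabs_le; lra.
Qed.

(** Corresponding positions on the plateaus of the cells j and j + 1 have phases that differ by j +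
    1. The difference t' - t fixes j, and t fixes the position u. As j is below [per N], the cell j
    + 1 is still one of the [per N + 1] cells. *)
Lemma staircase N t t' : (t < per N)%nat -> (t' < per N)%nat ->
  exists r, (r + cell N < per (S N))%nat /\
    height N r = 1 /\ phase N r = t /\
    height N (r + cell N) = 1 /\ phase N (r + cell N) = t'.
Proof.
  intros ht ht'. set (P := per N) in *.
  set (j := ((t' + P - t - 1) mod P)%nat).
  (* Modulo P, the multiple by P - 1 is the negative of [tri j], free of truncated subtraction. *)
  set (u := ((t + (P - 1) * tri j) mod P)%nat).
  assert (hj : (j < P)%nat) by (apply Nat.mod_upper_bound; lia).
  assert (hu : (u < P)%nat) by (apply Nat.mod_upper_bound; lia).
  assert (e1 : ((tri j + u) mod P = t)%nat).
  { unfold u. rewrite Nat.Div0.add_mod_idemp_r.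
    replace (tri j + (t + (P - 1) * tri j))%nat with (t + tri j * P)%nat by nia.
    rewrite Nat.Div0.mod_add. now apply Nat.mod_small. }
  assert (e2 : ((tri (S j) + u) mod P = t')%nat).
  { simpl tri. replace (tri j + S j + u)%nat with (tri j + u + (j + 1))%nat by lia.
    rewrite <- Nat.Div0.add_mod_idemp_l, e1. unfold j.
    rewrite Nat.add_assoc, (Nat.add_comm (t + _)), Nat.add_assoc, Nat.Div0.add_mod_idemp_r.
    replace (1 + t + (t' + P - t - 1))%nat with (t' + 1 * P)%nat by lia.
    rewrite Nat.Div0.mod_add. now apply Nat.mod_small. }
  exists (j * cell N + (ramp N + u))%nat.
  replace (j * cell N + (ramp N + u) + cell N)%nat with (S j * cell N + (ramp N + u))%nat by lia.
  rewrite !height_plateau, !phase_plateau by auto. unfold P in e1, e2. rewrite e1, e2. repeat split; auto.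
  rewrite per_S. pose proof (per_le_ramp N). fold P in H |- *. unfold cell in *. nia.
Qed.

Lemma norm_1 s : norm (1, s) = (1, s).
Proof. unfold norm; simpl. destruct Req_EM_T; [lra|easy]. Qed.

Lemma proj_near n w t : 0 <= fst w -> phase n t = snd w ->
  Rabs (height n t - fst w) <= / INR (S n) -> hdist w (proj n (1, t)) <= / INR (S n).
Proof.
  destruct w as [c s]. cbn [fst snd]. intros hc e h.
  unfold proj; cbn [fst snd]. rewrite e, hdist_norm_r by auto.
  now rewrite hdist_sym, hdist_same, Rmult_1_l.
Qed.

Section Mixing.
Variable m : nat.
Notation iter k x := (Nat.iter k (next m) x).

(** The time k depends on e only, so the same k serves both factors of the product system. *)
Lemma uniform_mixing e : 0 < e ->
  exists k, (0 < k)%nat /\ forall x y : pt m, exists z,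
    dist m x z < e /\ dist m y (iter k z) < e.
Proof.
  intros he. destruct (inv_S_small (e / 2)) as [n hn]; [lra|].
  exists (cell (S n)). split; [apply cell_gt0|]. intros x y. set (k := cell (S n)).
  (* [proj_dense] approximates level n by points of amplitude 1 at level n + 1, and [staircase]
     realises the two phases found there at positions k apart on level n + 2. The bound on r + k
     keeps the rotation by k from wrapping around. *)
  assert (ex : forall l, exists r, (r + k < per (S (S n)))%nat /\
    hdist (x n l) (proj n (proj (S n) (1, r))) <= / INR (S n) /\
    hdist (y n l) (proj n (proj (S n) (1, (r + k)%nat))) <= / INR (S n)).
  { intros l. pose proof (pt_spine m x n l) as (x1 & x2 & _).
    pose proof (pt_spine m y n l) as (y1 & y2 & _).
    destruct (proj_dense n _ _ x1 x2) as (t & ht & et & at_).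
    destruct (proj_dense n _ _ y1 y2) as (t' & ht' & et' & at').
    pose proof (cell_le_per n).
    destruct (staircase (S n) t t') as (r & hr & h1 & p1 & h2 & p2); try lia.
    exists r. split; [exact hr|].
    unfold proj at 2 4; cbn [fst snd]. fold k in h2, p2.
    rewrite h1, h2, p1, p2, Rmult_1_l, !norm_1.
    split; apply proj_near; auto. }
  apply choice in ex. destruct ex as [r hr].
  destruct (lift m (S (S n)) (fun l => if lt_dec l m then (1, r l) else (0, 0%nat))) as [z hz].
  { intros l. destruct (hr l) as [h _]. destruct lt_dec; [|apply spine_00].
    unfold spine; cbn [fst snd]. repeat split; try lra; try lia. }
  { intros l hl. destruct lt_dec; [lia|reflexivity]. }
  exists z. pose proof (inv_S n).
  assert (hz' : forall l, (l < m)%nat -> z (S (S n)) l = (1, r l)).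
  { intros l hl. rewrite hz. now destruct lt_dec. }
  split; (apply Rle_lt_trans with (2 * (2 / INR (S n))); [|lra]);
    apply (dist_le_level m _ _ n); unfold Rdiv; try lra; intros l hl;
    destruct (hr l) as (h0 & h1 & h2).
  - rewrite (pt_proj m z n), (pt_proj m z (S n)), hz' by auto. lra.
  - pose proof (iter_rot m k z (S (S n)) l) as h. rewrite hz' in h by auto.
    assert (E : rot (S (S n)) k (1, r l) = (1, (r l + k)%nat)).
    { unfold rot; cbn [fst snd]. rewrite norm_1. f_equal. now apply Nat.mod_small. }
    rewrite E in h.
    pose proof (eta_mult (S (S n)) k ltac:(lia)).
    pose proof (frac_mono n (S (S n)) ltac:(lia)).
    assert (hb : forall j t, 0 <= fst (proj j (1, t))).
    { intros. rewrite fst_proj. pose proof (height_bound j t). simpl. lra. }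
    assert (h3 : hdist (iter k z n l) (proj n (proj (S n) (1, (r l + k)%nat))) <= 2 / INR (S n)).
    { rewrite (pt_proj m _ n).
      eapply Rle_trans; [apply proj_lip; auto|]. rewrite (pt_proj m _ (S n)).
      eapply Rle_trans; [apply proj_lip; auto; simpl; lra|]. lra. }
    rewrite hdist_sym in h3.
    eapply Rle_trans; [apply (hdist_tri _ (proj n (proj (S n) (1, (r l + k)%nat)))); auto|].
    + rewrite fst_proj. pose proof (hb (S n) (r l + k)%nat).
      pose proof (height_bound n (snd (proj (S n) (1, (r l + k)%nat)))). nra.
    + unfold Rdiv in *. lra.
Qed.

Lemma iter_prod k (p : pt m * pt m) :
  Nat.iter k (prod_map (next m)) p = (iter k (fst p), iter k (snd p)).
Proof. induction k; simpl; [now destruct p|]. now rewrite IHk. Qed.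

Lemma next_weakly_mixing : weakly_mixing (dist m) (next m).
Proof.
  intros U V hU hV [[x1 x2] hx] [[y1 y2] hy].
  destruct (hU _ hx) as (e1 & he1 & h1). destruct (hV _ hy) as (e2 & he2 & h2).
  destruct (uniform_mixing (Rmin e1 e2)) as (k & hk & hz); [now apply Rmin_glb_lt|].
  exists k. split; auto.
  destruct (hz x1 y1) as (z1 & a1 & b1). destruct (hz x2 y2) as (z2 & a2 & b2).
  pose proof (Rmin_l e1 e2). pose proof (Rmin_r e1 e2).
  exists (z1, z2). split.
  - apply h1. unfold prod_metric; simpl. apply Rmax_lub_lt; lra.
  - apply h2. rewrite iter_prod. unfold prod_metric; simpl. apply Rmax_lub_lt; lra.
Qed.

End Mixing.

(** * Compactness *)

Definition complete (X : Type) (d : X -> X -> R) : Prop :=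
  forall u : nat -> X,
    (forall e, 0 < e -> exists K, forall i j, (K <= i)%nat -> (K <= j)%nat -> d (u i) (u j) < e) ->
    exists y, forall e, 0 < e -> exists K, forall i, (K <= i)%nat -> d (u i) y < e.

Definition finite_range (X A : Type) (f : X -> A) : Prop := exists K, forall x, In (f x) K.

Section Compact.
Variables (X : Type) (d : X -> X -> R).
Hypothesis dm : is_metric d.
Hypothesis dc : complete X d.
(** Total boundedness in the form in which the coordinates supply it: a function of finite range
    with small fibres. *)
Hypothesis small_keys : forall e, 0 < e ->
  exists (A : Type) (key : X -> A), finite_range X A key /\
    forall x y, key x = key y -> d x y < e.

Section Cover.
Variables (I : Type) (U : I -> X -> Prop).

Definition uncoverable (B : X -> Prop) : Prop :=
  ~ exists l : list I, forall x, B x -> exists i, In i l /\ U i x.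

(** If every fibre of the key within B had a finite subcover, joining these finitely many lists
    would cover B. *)
Lemma uncoverable_refine B e : uncoverable B -> 0 < e ->
  exists B', uncoverable B' /\ (forall x, B' x -> B x) /\ forall x y, B' x -> B' y -> d x y < e.
Proof.
  intros hB he. destruct (small_keys e he) as (A & key & [K hK] & hs).
  apply NNPP. intros hn. apply hB.
  assert (g : forall L : list A, exists l : list I,
    forall x, B x -> In (key x) L -> exists i, In i l /\ U i x).
  { induction L as [|a L [l hl]]; [exists nil; intros x _ []|].
    destruct (classic (uncoverable (fun x => B x /\ key x = a))) as [u|u].
    - exfalso. apply hn. eexists; split; [exact u|split].
      + now intros x [].
      + intros x y [_ ex] [_ ey]. apply hs. congruence.
    - apply NNPP in u. destruct u as [l' hl']. exists (l' ++ l). intros x hx [e'|hin].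
      + destruct (hl' x) as (i & hi & ui); auto. exists i. split; auto. apply in_or_app; auto.
      + destruct (hl x hx hin) as (i & hi & ui). exists i. split; auto. apply in_or_app; auto. }
  destruct (g K) as [l hl]. exists l. auto.
Qed.

Definition refine_pick (n : nat) (B : { B | uncoverable B }) : { B | uncoverable B }.
Proof.
  destruct B as [B hB].
  destruct (constructive_indefinite_description _
    (uncoverable_refine B (/ INR (S n)) hB (proj1 (inv_S n)))) as [B' h].
  exact (exist _ B' (proj1 h)).
Defined.

Lemma refine_pick_spec n B :
  (forall x, proj1_sig (refine_pick n B) x -> proj1_sig B x) /\
  (forall x y, proj1_sig (refine_pick n B) x -> proj1_sig (refine_pick n B) y ->
     d x y < / INR (S n)).
Proof.
  destruct B as [B hB]. unfold refine_pick.
  destruct constructive_indefinite_description as [B' h]. simpl. split; apply h.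
Qed.

(** Nested uncoverable sets of diameters tending to 0 have a limit point; an open set of the cover
    around it contains one of them, which is then covered by a single set. *)
Lemma not_uncoverable : (forall i, is_open d (U i)) -> (forall x, exists i, U i x) ->
  ~ uncoverable (fun _ => True).
Proof.
  intros ho hc h0. destruct dm as (_ & d0 & ds & dt).
  set (S0 := exist uncoverable _ h0).
  set (B := fix B n := match n with O => S0 | S n => refine_pick n (B n) end).
  assert (dec : forall j i x, proj1_sig (B (i + j)%nat) x -> proj1_sig (B i) x).
  { induction j as [|j IH]; intros i x; [now rewrite Nat.add_0_r|].
    rewrite <- plus_n_Sm. intros h. apply IH. now apply (refine_pick_spec (i + j)). }
  assert (ne : forall n, exists x, proj1_sig (B n) x).
  { intros n. apply NNPP. intros hn. apply (proj2_sig (B n)). exists nil.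
    intros x hx. exfalso. apply hn. now exists x. }
  apply choice in ne. destruct ne as [u hu].
  assert (sm : forall n i y, (S n <= i)%nat -> proj1_sig (B (S n)) y -> d (u i) y < / INR (S n)).
  { intros n i y hi hy. apply (refine_pick_spec n (B n)); auto.
    change (proj1_sig (B (S n)) (u i)). apply (dec (i - S n)%nat). replace (S n + (i - S n))%nat with i by lia. apply hu. }
  destruct (dc u) as [y hy].
  { intros e he. destruct (inv_S_small e he) as [n hn]. exists (S n). intros i j hi hj.
    pose proof (inv_S n). unfold Rdiv in hn.
    assert (d (u i) (u j) < / INR (S n)); [|lra].
    apply sm; auto. apply (dec (j - S n)%nat). replace (S n + (j - S n))%nat with j by lia. apply hu. }
  destruct (hc y) as [i hi]. destruct (ho i y hi) as (e & he & hb).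
  destruct (inv_S_small e he) as [n hn]. destruct (hy (e / 2)) as [K hK]; [lra|].
  apply (proj2_sig (B (S n))). exists (i :: nil). intros x hx. exists i. split; [now left|].
  apply hb. set (k := Nat.max (S n) K).
  pose proof (sm n k x ltac:(lia) hx). specialize (hK k ltac:(lia)). rewrite ds in hK.
  pose proof (dt y (u k) x). unfold Rdiv in *. lra.
Qed.

End Cover.

Lemma compact_of_keys : compact_space d.
Proof.
  intros I U ho hc. apply NNPP. intros hn. apply (not_uncoverable I U ho hc).
  intros [l hl]. apply hn. exists l. auto.
Qed.

End Compact.

Lemma finite_range_pair (X A B : Type) (f : X -> A) (g : X -> B) :
  finite_range X A f -> finite_range X B g -> finite_range X (A * B) (fun x => (f x, g x)).
Proof. intros [K hK] [L hL]. exists (list_prod K L). intros x. apply in_prod; auto. Qed.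

Lemma finite_range_map (X A : Type) (f : nat -> X -> A) (L : list nat) :
  (forall l, finite_range X A (f l)) ->
  finite_range X (list A) (fun x => map (fun l => f l x) L).
Proof.
  intros h. induction L as [|a L [K hK]]; simpl.
  - exists (nil :: nil). simpl; auto.
  - destruct (h a) as [K' hK']. exists (map (fun p => fst p :: snd p) (list_prod K' K)).
    intros x. apply (in_map (fun p => fst p :: snd p) _ (f a x, _)). apply in_prod; [apply hK'|apply hK].
Qed.

Lemma finite_range_nat (X : Type) (f : X -> nat) b :
  (forall x, (f x < b)%nat) -> finite_range X nat f.
Proof. intros h. exists (seq 0 b). intros x. apply in_seq. specialize (h x). lia. Qed.

Lemma map_eq_seq (A : Type) (f g : nat -> A) m l :
  map f (seq 0 m) = map g (seq 0 m) -> (l < m)%nat -> f l = g l.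
Proof.
  intros e h. assert (In l (seq 0 m)) by (apply in_seq; lia).
  clear h. induction (seq 0 m) as [|a s IH]; simpl in *; [easy|].
  injection e; intros. destruct H; subst; auto.
Qed.

Section SpaceCompact.
Variable m : nat.

Lemma nfloor_lt c M : 0 <= c <= 1 -> (nfloor (c * INR M) < S M)%nat.
Proof.
  intros hc. pose proof (pos_INR M). destruct (nfloor_spec (c * INR M)) as [h _]; [nra|].
  apply le_n_S, INR_le. nra.
Qed.

Lemma dist_complete : complete (pt m) (dist m).
Proof.
  intros u hu. destruct (levelwise_complete m u) as [y hy].
  - intros n l e he. assert (hS : 0 < INR (S n)) by (apply lt_0_INR; lia).
    destruct (hu (e / INR (S n))) as [K hK]; [now apply Rdiv_lt_0_compat|].
    exists K. intros i j hi hj. specialize (hK i j hi hj).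
    pose proof (level_le_dist m (u i) (u j) n l).
    apply (Rmult_lt_compat_l (INR (S n))) in hK; auto.
    replace (INR (S n) * (e / INR (S n))) with e in hK by (field; lra). lra.
  - exists y. intros e he. destruct (inv_S_small (e / 2)) as [n hn]; [lra|].
    assert (un : forall b, exists K, forall l, (l < b)%nat -> forall i, (K <= i)%nat ->
      hdist (u i n l) (y n l) <= e / 2).
    { induction b as [|m' [K hK]]; [exists 0%nat; lia|].
      destruct (hy n m' (e / 2)) as [K' hK']; [lra|].
      exists (Nat.max K K'). intros l hl i hi.
      destruct (Nat.eq_dec l m') as [->|]; [apply hK'|apply hK]; lia. }
    destruct (un m) as [K hK]. exists K. intros i hi. apply Rle_lt_trans with (e / 2); [|lra].
    apply (dist_le_level m _ _ n); try lra. intros. now apply hK.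
Qed.

Lemma pt_compact : compact_space (dist m).
Proof.
  apply compact_of_keys; [apply dist_metric|apply dist_complete|].
  intros e he. destruct (inv_S_small (e / 2)) as [n hn]; [lra|].
  set (key := fun (l : nat) (x : pt m) => (nfloor (fst (x n l) * INR (S n)), snd (x n l))).
  exists _, (fun x => map (fun l => key l x) (seq 0 m)). split.
  - apply finite_range_map. intros l. apply finite_range_pair.
    + apply finite_range_nat with (S (S n)). intros x. apply nfloor_lt. apply pt_spine.
    + apply finite_range_nat with (per n). intros x. apply pt_spine.
  - intros x y hk. apply Rle_lt_trans with (e / 2); [|lra].
    apply (dist_le_level m _ _ n); try lra. intros l hl.
    pose proof (map_eq_seq _ (fun l => key l x) (fun l => key l y) _ _ hk hl) as E.
    pose proof (f_equal fst E) as e1. pose proof (f_equal snd E) as e2.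
    unfold key in e1, e2. cbn [fst snd] in e1, e2. assert (hS : 0 < INR (S n)) by (apply lt_0_INR; lia).
    destruct (nfloor_spec (fst (x n l) * INR (S n))) as [a1 a2];
      [apply Rmult_le_pos; auto; lra|].
    destruct (nfloor_spec (fst (y n l) * INR (S n))) as [b1 b2];
      [apply Rmult_le_pos; auto; lra|].
    rewrite e1 in a1, a2. unfold hdist. destruct Nat.eq_dec; [|contradiction].
    pose proof (inv_S n). apply Rle_trans with (/ INR (S n)); [|unfold Rdiv in hn; lra].
    apply Rmult_le_reg_r with (INR (S n)); auto. rewrite Rinv_l by lra.
    rewrite <- (Rabs_pos_eq (INR (S n))) at 1 by lra. rewrite <- Rabs_mult.
    apply Rabs_le. lra.
Qed.

End SpaceCompact.

(** * Covering dimension *)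

Lemma common_radius (P : nat -> R -> Prop) :
  (forall l r r', P l r -> r' <= r -> P l r') ->
  (forall l, exists r, 0 < r /\ P l r) ->
  forall b, exists r, 0 < r /\ forall l, (l < b)%nat -> P l r.
Proof.
  intros mono ex b. induction b as [|b [r [r0 hr]]].
  - exists 1. split; [lra|]. intros; lia.
  - destruct (ex b) as [s [s0 hs]]. exists (Rmin r s). split; [now apply Rmin_glb_lt|].
    intros l hl. destruct (Nat.eq_dec l b) as [->|].
    + apply mono with s; auto. apply Rmin_r.
    + apply mono with r; [apply hr; lia|apply Rmin_l].
Qed.

Lemma NoDup_list_prod (A B : Type) (L : list A) (K : list B) :
  NoDup L -> NoDup K -> NoDup (list_prod L K).
Proof.
  intros nL nK. induction nL as [|a L hin nL IH]; simpl; [constructor|].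
  apply NoDup_app; auto.
  - apply NoDup_map_NoDup_ForallPairs; auto. intros x y _ _ e. congruence.
  - intros [x y] h1 h2. apply in_map_iff in h1. destruct h1 as (z & e & _).
    apply in_prod_iff in h2. injection e; intros; subst. now apply hin.
Qed.

Section Covers.
Variables (X : Type) (d : X -> X -> R).
Hypothesis dm : is_metric d.
Hypothesis dcomp : compact_space d.

Lemma ball_open z r : is_open d (fun y => d z y < r).
Proof.
  destruct dm as (_ & _ & _ & dt). intros y hy. exists (r - d z y). split; [lra|].
  intros y' h. pose proof (dt z y y'). lra.
Qed.

Lemma lebesgue_number C : finite_open_cover d C ->
  exists lam, 0 < lam /\ forall x, exists U, In U C /\ forall y, d x y < lam -> U y.
Proof.
  intros [ho hc]. destruct dm as (_ & d0 & ds & dt).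
  assert (ex : forall x, exists Ue : (X -> Prop) * R,
    In (fst Ue) C /\ 0 < snd Ue /\ forall y, d x y < snd Ue -> fst Ue y).
  { intros x. destruct (hc x) as (U & hU & ux). destruct (ho U hU x ux) as (e & he & h).
    now exists (U, e). }
  apply choice in ex. destruct ex as [f hf].
  destruct (dcomp X (fun z y => d z y < snd (f z) / 2)) as [l hl].
  - intros z. apply ball_open.
  - intros x. exists x. destruct (hf x) as (_ & h & _).
    rewrite (proj2 (d0 x x) eq_refl). lra.
  - assert (hlam : exists lam, 0 < lam /\ forall z, In z l -> lam <= snd (f z) / 2).
    { clear hl. induction l as [|z l [lam [h1 h2]]].
      - exists 1. split; [lra|]. intros z [].
      - exists (Rmin lam (snd (f z) / 2)). destruct (hf z) as (_ & h & _). split.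
        + apply Rmin_glb_lt; lra.
        + intros z' [<-|hin]; [apply Rmin_r|].
          eapply Rle_trans; [apply Rmin_l|auto]. }
    destruct hlam as (lam & h1 & h2). exists lam. split; auto. intros x.
    destruct (hl x) as (z & hz & hx). destruct (hf z) as (a1 & a2 & a3).
    exists (fst (f z)). split; auto. intros y hy. apply a3.
    pose proof (dt z x y). specialize (h2 z hz). lra.
Qed.

(* Each colour [i] gives a disjoint family of small open sets, the level sets of
   [key i] inside [good i]; a cover by [S k] such families has order at most [k]. *)
Lemma covdim_of_colors (k : nat) (x0 : X) :
  (forall e, 0 < e -> exists (A : Type) (key : nat -> X -> A) (good : nat -> X -> Prop),
    (forall i, finite_range X A (key i)) /\
    (forall x, exists i, (i <= k)%nat /\ good i x) /\
    (forall i x, (i <= k)%nat -> good i x -> exists r, 0 < r /\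
       forall y, d x y < r -> good i y /\ key i y = key i x) /\
    (forall i x y, (i <= k)%nat -> good i x -> good i y -> key i x = key i y -> d x y < e)) ->
  covdim_le d k.
Proof.
  intros H C hC. destruct (lebesgue_number C hC) as (lam & lam0 & hlam).
  destruct (H lam lam0) as (A & key & good & hfin & hcov & hopen & hsmall).
  assert (hK : exists K, NoDup K /\ forall i x, (i < S k)%nat -> In (key i x) K).
  { assert (h : forall b, exists K, forall i x, (i < b)%nat -> In (key i x) K).
    { induction b as [|b [K hK]]; [exists nil; lia|].
      destruct (hfin b) as [L hL]. exists (K ++ L). intros i x hi. apply in_or_app.
      destruct (Nat.eq_dec i b) as [->|]; [right; apply hL|left; apply hK; lia]. }
    destruct (h (S k)) as [K hK].
    (* Repetitions are removed because [order_le] counts positions in the list, not sets. *)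
    exists (nodup (fun a b => excluded_middle_informative (a = b)) K).
    split; [apply NoDup_nodup|]. intros. apply nodup_In. auto. }
  destruct hK as (K & nK & hK).
  set (P := list_prod (seq 0 (S k)) K).
  assert (nP : NoDup P) by (apply NoDup_list_prod; [apply seq_NoDup|exact nK]).
  set (F := fun (p : nat * A) (x : X) => good (fst p) x /\ key (fst p) x = snd p).
  exists (map F P). split; [|split].
  - split.
    + intros U hU. apply in_map_iff in hU. destruct hU as ([i a] & <- & hin).
      apply in_prod_iff in hin. destruct hin as [hi _]. apply in_seq in hi.
      intros x [gx kx]. simpl in *. destruct (hopen i x ltac:(lia) gx) as (r & r0 & hr).
      exists r. split; auto. intros y hy. destruct (hr y hy). split; simpl; congruence.
    + intros x. destruct (hcov x) as (i & hi & gi). exists (F (i, key i x)). split.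
      * apply in_map. apply in_prod; [apply in_seq; lia|apply hK; lia].
      * now split.
  - intros W hW. apply in_map_iff in hW. destruct hW as ([i a] & <- & hin).
    apply in_prod_iff in hin. destruct hin as [hi _]. apply in_seq in hi.
    destruct (classic (exists x, F (i, a) x)) as [[x [gx kx]]|hn].
    + destruct (hlam x) as (U & hU & hb). exists U. split; auto. intros y [gy ky].
      apply hb. simpl in *. apply (hsmall i); auto; [lia|congruence].
    + destruct (proj2 hC x0) as (U & hU & _). exists U. split; auto.
      intros x hx. exfalso; apply hn; eauto.
  - intros x idx nidx hidx.
    assert (get : forall i, In i idx -> exists c, nth_error P i = Some (c, key c x)).
    { intros i hi. destruct (hidx i hi) as [h1 h2]. rewrite length_map in h1.
      destruct (nth_error P i) as [[c a]|] eqn:E.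
      - rewrite (nth_error_nth (map F P) i _ (map_nth_error F i P E)) in h2.
        destruct h2 as [_ h2]. simpl in h2. exists c. now rewrite h2.
      - apply nth_error_None in E. lia. }
    (* A point lies in at most one set of each colour, so the colour is injective on the positions
       that contain x. *)
    set (col := fun i => match nth_error P i with Some p => fst p | None => 0%nat end).
    rewrite <- (length_map col idx).
    rewrite <- (length_seq (S k) 0). apply NoDup_incl_length.
    + apply NoDup_map_NoDup_ForallPairs; auto. intros i j hi hj. unfold col.
      destruct (get i hi) as [c e], (get j hj) as [c' e']. rewrite e, e'. simpl.
      intros <-. rewrite NoDup_nth_error in nP. apply nP; [|congruence].
      apply nth_error_Some. congruence.
    + intros c hc. apply in_map_iff in hc. destruct hc as (i & <- & hi).
      unfold col. destruct (get i hi) as [c e]. rewrite e. simpl.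
      apply nth_error_In, in_prod_iff in e. apply e.
Qed.

End Covers.

(** * Upper bound: coloured cuts of the hedgehogs *)

Section UpperBound.
Variable m : nat.

(* The cuts of colour [i] are the points of amplitude [z / S n + (i + 1) / ((m + 2) S n)],
   [z] an integer; distinct colours have disjoint cuts. *)
Definition offset (n i : nat) (a : R * nat) : R :=
  fst a * INR (S n) - INR (S i) / INR (S (S m)) + 1.

Definition uncut (n i : nat) (a : R * nat) : Prop :=
  INR (nfloor (offset n i a)) < offset n i a.

(** The summand 1 keeps [offset] positive for colours up to m. Floor 0 is then the star around the
    hub, where all branches meet and the phase is forgotten; any other piece lies on one branch. *)
Definition piece (n i : nat) (a : R * nat) : nat * nat :=
  let j := nfloor (offset n i a) in (j, match j with O => O | _ => snd a end).

Lemma color_frac i : (i <= m)%nat -> 0 < INR (S i) / INR (S (S m)) < 1.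
Proof.
  intros hi. assert (0 < INR (S (S m))) by (apply lt_0_INR; lia).
  split; [apply Rdiv_lt_0_compat; auto; apply lt_0_INR; lia|].
  apply Rmult_lt_reg_r with (INR (S (S m))); auto. unfold Rdiv.
  rewrite Rmult_assoc, Rinv_l, Rmult_1_r, Rmult_1_l by lra. apply lt_INR. lia.
Qed.

Lemma offset_pos n i a : (i <= m)%nat -> 0 <= fst a -> 0 < offset n i a.
Proof.
  intros hi ha. unfold offset. pose proof (color_frac i hi). pose proof (pos_INR (S n)). nra.
Qed.

Lemma nfloor_unique r j : INR j <= r < INR j + 1 -> nfloor r = j.
Proof.
  intros h. pose proof (pos_INR j). destruct (nfloor_spec r) as [h1 h2]; [lra|].
  assert (nfloor r < S j)%nat by (apply INR_lt; rewrite S_INR; lra).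
  assert (j < S (nfloor r))%nat by (apply INR_lt; rewrite S_INR; lra). lia.
Qed.

Lemma piece_open n i a : (i <= m)%nat -> 0 <= fst a -> uncut n i a ->
  exists r, 0 < r /\ forall b, 0 <= fst b -> hdist a b < r ->
    uncut n i b /\ piece n i b = piece n i a.
Proof.
  intros hi ha hu. unfold uncut, piece in *.
  destruct (nfloor_spec (offset n i a)) as [_ h2]; [apply Rlt_le; now apply offset_pos|].
  set (j := nfloor (offset n i a)) in *.
  assert (hS : 0 < INR (S n)) by (apply lt_0_INR; lia).
  set (r0 := Rmin (offset n i a - INR j) (INR j + 1 - offset n i a)).
  assert (r0p : 0 < r0) by (apply Rmin_glb_lt; lra).
  (* Within distance [fst a] the branch cannot change. At the hub any radius does, since the hub
     belongs to piece 0, which ignores the branch. *)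
  set (r1 := if Req_EM_T (fst a) 0 then 1 else fst a).
  assert (r1p : 0 < r1) by (unfold r1; destruct Req_EM_T; lra).
  exists (Rmin (r0 / INR (S n)) r1). split.
  { apply Rmin_glb_lt; auto. now apply Rdiv_lt_0_compat. }
  intros b hb hd.
  assert (d1 : hdist a b * INR (S n) < r0).
  { assert (hd' : hdist a b < r0 / INR (S n)) by (eapply Rlt_le_trans; [exact hd|apply Rmin_l]).
    apply (Rmult_lt_compat_r (INR (S n))) in hd'; auto.
    unfold Rdiv in hd'. rewrite Rmult_assoc, Rinv_l in hd'; lra. }
  assert (d2 : hdist a b < r1) by (eapply Rlt_le_trans; [exact hd|apply Rmin_r]).
  assert (dw : Rabs (offset n i a - offset n i b) < r0).
  { unfold offset.
    match goal with |- Rabs ?e < _ =>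
      replace e with ((fst a - fst b) * INR (S n)) by ring end.
    rewrite Rabs_mult, (Rabs_pos_eq (INR (S n))) by lra.
    pose proof (hdist_fst a b ha hb). nra. }
  apply Rabs_def2 in dw.
  assert (r0 <= offset n i a - INR j) by apply Rmin_l.
  assert (r0 <= INR j + 1 - offset n i a) by apply Rmin_r.
  assert (E : nfloor (offset n i b) = j) by (apply nfloor_unique; lra).
  rewrite E. split; [lra|]. f_equal. destruct j as [|j']; auto.
  assert (fst a <> 0).
  { intros e. unfold offset in hu. rewrite e, S_INR in hu. pose proof (color_frac i hi).
    pose proof (pos_INR j'). lra. }
  unfold r1 in d2. destruct Req_EM_T; [contradiction|].
  unfold hdist in d2. destruct Nat.eq_dec; auto. lra.
Qed.

Lemma piece_small n i a b : (i <= m)%nat -> 0 <= fst a -> 0 <= fst b ->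
  piece n i a = piece n i b -> hdist a b <= 2 / INR (S n).
Proof.
  intros hi ha hb e. unfold piece in e.
  assert (hS : 0 < INR (S n)) by (apply lt_0_INR; lia).
  destruct (nfloor_spec (offset n i a)) as [a1 a2]; [apply Rlt_le; now apply offset_pos|].
  destruct (nfloor_spec (offset n i b)) as [b1 b2]; [apply Rlt_le; now apply offset_pos|].
  apply pair_equal_spec in e. destruct e as [e1 e2]. rewrite <- e1 in b1, b2, e2.
  pose proof (color_frac i hi).
  apply Rmult_le_reg_r with (INR (S n)); auto. unfold Rdiv at 1.
  rewrite Rmult_assoc, Rinv_l, Rmult_1_r by lra.
  destruct (nfloor (offset n i a)) as [|j].
  - unfold offset in *. simpl (INR 0) in *.
    pose proof (hdist_le_sum a b ha hb).
    apply Rle_trans with ((fst a + fst b) * INR (S n)); [apply Rmult_le_compat_r|]; lra.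
  - unfold hdist. destruct Nat.eq_dec; [|contradiction].
    rewrite <- (Rabs_pos_eq (INR (S n))) by lra. rewrite <- Rabs_mult.
    apply Rabs_le. unfold offset in *. lra.
Qed.

(** Multiplying the equations of the two cuts by m + 2 shows that i and i' agree modulo m + 2. *)
Lemma cut_color n i i' a : (i <= m)%nat -> (i' <= m)%nat -> 0 <= fst a ->
  ~ uncut n i a -> ~ uncut n i' a -> i = i'.
Proof.
  intros hi hi' ha h h'. unfold uncut in *.
  destruct (nfloor_spec (offset n i a)) as [a1 _]; [apply Rlt_le; now apply offset_pos|].
  destruct (nfloor_spec (offset n i' a)) as [b1 _]; [apply Rlt_le; now apply offset_pos|].
  set (j := nfloor (offset n i a)) in *. set (j' := nfloor (offset n i' a)) in *.
  assert (e : offset n i a = INR j) by lra. assert (e' : offset n i' a = INR j') by lra.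
  unfold offset in e, e'. set (q := INR (S (S m))) in *.
  assert (hq : q <> 0) by (apply not_0_INR; lia).
  assert (E : INR (S i) + INR j * q = INR (S i') + INR j' * q).
  { assert (INR (S i) / q + INR j = INR (S i') / q + INR j') by lra.
    replace (INR (S i) + INR j * q) with ((INR (S i) / q + INR j) * q) by (now field).
    rewrite H. now field. }
  unfold q in E. rewrite <- !mult_INR, <- !plus_INR in E. apply INR_eq in E.
  destruct (Nat.lt_trichotomy j j') as [|[|]]; nia.
Qed.

(** Pigeonhole: each of the m coordinates is cut by at most one of the m + 1 colours. *)
Lemma uncut_color n (x : pt m) :
  exists i, (i <= m)%nat /\ forall l, (l < m)%nat -> uncut n i (x n l).
Proof.
  apply NNPP. intros hn.
  assert (ex : forall i, exists l, (i <= m)%nat -> (l < m)%nat /\ ~ uncut n i (x n l)).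
  { intros i. apply NNPP. intros h. apply hn. exists i.
    assert (hi : (i <= m)%nat).
    { destruct (Nat.le_gt_cases i m); auto. exfalso. apply h. exists 0%nat. lia. }
    split; auto. intros l hl. apply NNPP. intros hu. apply h. exists l. auto. }
  apply choice in ex. destruct ex as [f hf].
  assert (nd : NoDup (map f (seq 0 (S m)))).
  { apply NoDup_map_NoDup_ForallPairs; [|apply seq_NoDup].
    intros i j hi hj e. apply in_seq in hi, hj.
    destruct (hf i ltac:(lia)) as [_ h1]. destruct (hf j ltac:(lia)) as [_ h2].
    rewrite <- e in h2. apply (cut_color n i j (x n (f i))); auto; lia. }
  assert (inc : incl (map f (seq 0 (S m))) (seq 0 m)).
  { intros l hl. apply in_map_iff in hl. destruct hl as (i & <- & hi). apply in_seq in hi.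
    apply in_seq. destruct (hf i ltac:(lia)). lia. }
  pose proof (NoDup_incl_length nd inc) as h. rewrite length_map, !length_seq in h. lia.
Qed.

Lemma pt_inhabited : exists x : pt m, True.
Proof.
  destruct (lift m 0 (fun _ => (0, 0%nat))) as [x _]; auto using spine_00. now exists x.
Qed.

Lemma covdim_upper : covdim_le (dist m) m.
Proof.
  destruct pt_inhabited as [x0 _].
  apply covdim_of_colors; auto using dist_metric, pt_compact.
  intros e he. destruct (inv_S_small (e / 2)) as [n hn]; [lra|].
  exists _, (fun i (x : pt m) => map (fun l => piece n i (x n l)) (seq 0 m)),
    (fun i x => forall l, (l < m)%nat -> uncut n i (x n l)).
  split; [|split; [apply uncut_color|split]].
  - intros i. apply (finite_range_map _ _ (fun l (x : pt m) => piece n i (x n l))). intros l.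
    apply finite_range_pair.
    + apply finite_range_nat with (S (S n + 1)). intros x.
      apply le_n_S, INR_le. unfold offset.
      assert (0 <= INR (S i) / INR (S (S m))).
      { apply Rle_mult_inv_pos; [apply pos_INR|apply lt_0_INR; lia]. }
      set (r := fst (x n l) * INR (S n) - INR (S i) / INR (S (S m)) + 1).
      assert (r <= INR (S n + 1)).
      { unfold r. rewrite plus_INR. simpl (INR 1). pose proof (pt_le1 m x n l).
        pose proof (pos_INR (S n)). nra. }
      destruct (Rle_lt_dec 0 r) as [h0|h0].
      * destruct (nfloor_spec r h0). lra.
      * unfold nfloor. replace (Z.to_nat (Int_part r)) with 0%nat; [apply pos_INR|].
        destruct (base_Int_part r) as [h1 _].
        assert (Int_part r < 0)%Z by (apply lt_IZR; lra). lia.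
    + apply finite_range_nat with (per n). intros x.
      pose proof (per_gt0 n). pose proof (pt_spine m x n l) as (_ & h & _).
      destruct (nfloor (offset n i (x n l))); auto.
  - intros i x hi hx.
    destruct (common_radius (fun l r => (l < m)%nat -> forall b, 0 <= fst b ->
        hdist (x n l) b < r -> uncut n i b /\ piece n i b = piece n i (x n l))) with (b := m)
      as (r & r0 & hr).
    + intros l r r' h hle hl b hb hd. apply h; auto. lra.
    + intros l. destruct (lt_dec l m) as [hl|hl].
      * destruct (piece_open n i (x n l) hi ltac:(auto) (hx l hl)) as (r & r0 & hr).
        exists r. auto.
      * exists 1. split; [lra|]. intros; contradiction.
    + assert (hS : 0 < INR (S n)) by (apply lt_0_INR; lia).
      exists (r / INR (S n)). split; [now apply Rdiv_lt_0_compat|]. intros y hy.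
      assert (hl : forall l, (l < m)%nat ->
        uncut n i (y n l) /\ piece n i (y n l) = piece n i (x n l)).
      { intros l hl. apply hr; auto. pose proof (level_le_dist m x y n l).
        apply (Rmult_lt_compat_l (INR (S n))) in hy; auto.
        replace (INR (S n) * (r / INR (S n))) with r in hy by (field; lra). lra. }
      split; [intros l h; now apply hl|].
      apply map_ext_in. intros l h. apply in_seq in h. apply hl. lia.
  - intros i x y hi _ _ e'. apply Rle_lt_trans with (e / 2); [|lra].
    apply (dist_le_level m _ _ n); try lra. intros l hl.
    pose proof (map_eq_seq _ (fun l => piece n i (x n l)) (fun l => piece n i (y n l)) _ _ e' hl)
      as h. apply (piece_small n i) in h; auto. lra.
Qed.

End UpperBound.

(** * Lower bound: Lebesgue's covering theorem *)

Section LowerBound.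
Variable m : nat.

(** The labelling given to Sperner's lemma is defined on all functions; the truncation at 1 gives a
    point of the cube for values beyond N + 1 as well. *)
Definition grid (N : nat) (g : nat -> nat) (l : nat) : R * nat :=
  if lt_dec l m then (Rmin 1 (INR (g l) / INR (S N)), 0%nat) else (0, 0%nat).

Lemma grid_spine N g l : spine 1 (grid N g l).
Proof.
  unfold grid. destruct lt_dec; [|apply (spine_00 0)]. unfold spine; cbn [fst snd]. repeat split; auto.
  - apply Rmin_glb; [lra|]. apply Rle_mult_inv_pos; [apply pos_INR|apply lt_0_INR; lia].
  - apply Rmin_l.
Qed.

Lemma grid_out N g l : (m <= l)%nat -> grid N g l = (0, 0%nat).
Proof. intros h. unfold grid. destruct lt_dec; [lia|easy]. Qed.

(* The section [0,1]^m -> Y of the projection to level [0], on grid points. *)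
Definition grid_pt (N : nat) (g : nat -> nat) : pt m :=
  exist _ _ (lift_thread m 0 (grid N g) (grid_spine N g) (grid_out N g)).

Lemma grid_pt_0 N g l : grid_pt N g 0%nat l = grid N g l.
Proof. reflexivity. Qed.

Lemma grid_pt_dist N g g' :
  (forall l, (l < m)%nat -> (g l <= S (g' l))%nat /\ (g' l <= S (g l))%nat) ->
  dist m (grid_pt N g) (grid_pt N g') <= / INR (S N).
Proof.
  intros h. pose proof (inv_S N). apply dist_le. intros n l.
  assert (hdist (grid_pt N g n l) (grid_pt N g' n l) <= / INR (S N)).
  { change (hdist (up 0 n (grid N g l)) (up 0 n (grid N g' l)) <= / INR (S N)).
    eapply Rle_trans; [apply up_lip; apply grid_spine|].
    unfold grid. destruct lt_dec as [hl|]; [|rewrite hdist_refl; lra].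
    rewrite hdist_same. apply Rmin_lip; [rewrite Rminus_diag, Rabs_R0; lra|].
    unfold Rdiv. rewrite <- Rmult_minus_distr_r, Rabs_mult, (Rabs_pos_eq (/ _)) by lra.
    destruct (h l hl) as [h1 h2]. apply le_INR in h1, h2. rewrite S_INR in h1, h2.
    assert (Rabs (INR (g l) - INR (g' l)) <= 1) by (apply Rabs_le; lra). nra. }
  pose proof (inv_S n). pose proof (hdist_le2 m (grid_pt N g) (grid_pt N g') n l).
  unfold Rdiv. nra.
Qed.

(** The value b stands for the absence of such an index; it becomes the label m. *)
Lemma first_index (P : nat -> Prop) b :
  exists a, (a <= b)%nat /\ (forall i, (i < b)%nat -> P i -> (a <= i)%nat) /\ ((a < b)%nat -> P a).
Proof.
  induction b as [|b (a & h1 & h2 & h3)].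
  - exists 0%nat. repeat split; intros; lia.
  - destruct (Nat.eq_dec a b) as [->|ne].
    + destruct (classic (P b)).
      * exists b. repeat split; auto. intros i hi hp.
        destruct (Nat.eq_dec i b); [lia|]. apply h2; auto; lia.
      * exists (S b). repeat split; auto; [|lia]. intros i hi hp.
        destruct (Nat.eq_dec i b) as [->|]; [contradiction|].
        pose proof (h2 i ltac:(lia) hp). lia.
    + exists a. repeat split; [lia| |intros; apply h3; lia]. intros i hi hp.
      destruct (Nat.eq_dec i b); [lia|]. apply h2; auto; lia.
Qed.

(** Members of a fine cover cannot meet opposite faces of the cube, so each grid point gets a
    Sperner label from a member around it. A fully labelled simplex smaller than a Lebesgue number
    then yields m + 1 different members with a common point. *)
Lemma covdim_lower k : covdim_le (dist m) k -> (m <= k)%nat.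
Proof.
  intros hk. destruct (Nat.le_gt_cases m k) as [|hlt]; auto. exfalso.
  pose proof (dist_metric m) as dm. destruct dm as (_ & d0 & ds & _).
  destruct (pt_compact m (pt m) (fun z y => dist m z y < / 2)) as [L hL].
  { intros z. apply ball_open, dist_metric. }
  { intros x. exists x. rewrite (proj2 (d0 x x) eq_refl). lra. }
  destruct (hk (map (fun z y => dist m z y < / 2) L)) as (V & hV & href & hord).
  { split.
    - intros U hU. apply in_map_iff in hU. destruct hU as (z & <- & _).
      apply ball_open, dist_metric.
    - intros x. destruct (hL x) as (z & hz & hx). exists (fun y => dist m z y < / 2). split; [|exact hx].
      now apply (in_map (fun z y => dist m z y < / 2)). }
  (* [dist] dominates the distance at level 0, so an open ball of radius 1/2 cannot meet both the
     amplitudes 0 and 1 there. *)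
  assert (narrow : forall j y y' i, (j < length V)%nat ->
    nth j V (fun _ => False) y -> nth j V (fun _ => False) y' ->
    fst (y 0%nat i) = 0 -> fst (y' 0%nat i) = 1 -> False).
  { intros j y y' i hj hy hy' e e'.
    destruct (href _ (nth_In V (fun _ => False) hj)) as (U & hU & sub).
    apply in_map_iff in hU. destruct hU as (z & <- & _).
    pose proof (sub y hy) as b. pose proof (sub y' hy') as b'. cbn beta in b, b'.
    pose proof (level_le_dist m z y 0 i). pose proof (level_le_dist m z y' 0 i).
    pose proof (hdist_fst (z 0%nat i) (y 0%nat i) ltac:(auto) ltac:(auto)) as f1.
    pose proof (hdist_fst (z 0%nat i) (y' 0%nat i) ltac:(auto) ltac:(auto)) as f2.
    rewrite e in f1. rewrite e' in f2. simpl (INR 1) in *.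
    unfold Rabs in f1, f2. repeat destruct Rcase_abs; lra. }
  destruct (lebesgue_number _ _ (dist_metric m) (pt_compact m) V hV) as (lam & lam0 & hlam).
  destruct (inv_S_small lam lam0) as [N hN].
  assert (exJ : forall g, exists j, (j < length V)%nat /\
    forall y, dist m (grid_pt N g) y < lam -> nth j V (fun _ => False) y).
  { intros g. destruct (hlam (grid_pt N g)) as (U & hU & hb).
    apply (In_nth _ _ (fun _ => False)) in hU. destruct hU as (j & hj & <-). eauto. }
  apply choice in exJ. destruct exJ as [J hJ].
  (* The label of a grid point will depend only on its member [J g], so different labels force
     different positions in [V]. *)
  set (touch := fun j i => exists y : pt m, nth j V (fun _ => False) y /\ fst (y 0%nat i) = 0).
  assert (exl := fun j => first_index (touch j) m).
  apply choice in exl. destruct exl as [lab hl].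
  assert (self : forall g, nth (J g) V (fun _ => False) (grid_pt N g)).
  { intros g. apply hJ. rewrite (proj2 (d0 _ _) eq_refl). lra. }
  assert (hS : 0 < INR (S N)) by (apply lt_0_INR; lia).
  destruct (@Sperner.sperner m N (fun g => lab (J g))) as (w & w1 & w2).
  - intros g. apply (proj1 (hl (J g))).
  - intros g i hi e. apply (proj1 (proj2 (hl (J g)))); auto. exists (grid_pt N g). split; [apply self|].
    rewrite grid_pt_0. unfold grid. destruct lt_dec; [|contradiction].
    cbn [fst snd]. rewrite e. simpl (INR 0). unfold Rdiv. rewrite Rmult_0_l. apply Rmin_right. lra.
  - intros g i hi e el. destruct (hl (J g)) as (_ & _ & h3). rewrite el in h3.
    destruct (h3 hi) as (y & hy & ey). apply (narrow (J g) y (grid_pt N g) i); auto.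
    + apply hJ.
    + rewrite grid_pt_0. unfold grid. destruct lt_dec; [|contradiction].
      cbn [fst snd]. rewrite e. unfold Rdiv. rewrite Rinv_r by lra. apply Rmin_left. lra.
  (* All m + 1 members contain the vertex [w 0], because the vertices of the simplex are less than
     [lam] apart. *)
  - specialize (hord (grid_pt N (w 0%nat)) (map (fun a => J (w a)) (seq 0 (S m)))).
    rewrite length_map, length_seq in hord.
    assert (S m <= S k)%nat; [|lia]. apply hord.
    + apply NoDup_map_NoDup_ForallPairs; [|apply seq_NoDup].
      intros a b ha hb e. apply in_seq in ha, hb.
      destruct (w1 a ltac:(lia)) as [<- _]. destruct (w1 b ltac:(lia)) as [<- _].
      now rewrite e.
    + intros j hj. apply in_map_iff in hj. destruct hj as (a & <- & _).
      split; [apply hJ|]. apply hJ. pose proof (inv_S N).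
      eapply Rle_lt_trans; [apply grid_pt_dist|unfold Rdiv in hN; lra].
      intros l h. split; auto.
Qed.

End LowerBound.

Theorem theorem1p3 : forall n : nat, (1 <= n)%nat ->
  exists (Y : Type) (d : Y -> Y -> R) (S : Y -> Y),
    is_metric d /\ compact_space d /\ covering_dim d n /\
    homeomorphism d S /\ weakly_mixing d S /\ completely_scrambled d S.
Proof.
  intros n _. exists (pt n), (dist n), (next n).
  split; [apply dist_metric|]. split; [apply pt_compact|].
  split; [split; [apply covdim_upper|apply covdim_lower]|].
  split; [apply next_homeo|]. split; [apply next_weakly_mixing|apply next_scrambled].
Qed.
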